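(* Let $\eta:\mathbb{R}\to\mathbb{R}$ be differentiable and strictly convex, and let $\Phi$ be a class of functions $\mathcal{X}\to\mathbb{R}$ containing the true density ratio $\phi(x)=p(x)/p(x\mid y_s)$, with $\sup_{\hat\phi\in\Phi}\|\hat\phi\|_\infty\le C_\phi$. Assume that on $[-C_\phi,C_\phi]$, $\eta$ is $L_\eta$-Lipschitz with $|\eta|\le C_\eta$, and $\eta'$ is $L'_\eta$-Lipschitz. Let $x_1,\dots,x_n$ be i.i.d. from $p(x\mid y_s)$, $x^u_1,\dots,x^u_{n_u}$ i.i.d. from $p(x)$, and $\hat\phi^*\in\arg\min_{\hat\phi\in\Phi}\hat J_\eta(\hat\phi)$. Then there exist constants $C_1,C_2,M_1,M_2>0$ depending only on $C_\phi,L_\eta,L'_\eta,C_\eta$ such that for any $0<\delta<1$, with probability at least $1-\delta$, $$\mathrm{BR}_\eta(\phi\,\|\,\hat\phi^* )\le C_1\mathfrak{R}_n(\Phi)+C_2\mathfrak{R}^u_{n_u}(\Phi)+M_1\sqrt{\frac{\ln(4/\delta)}{2n}}+M_2\sqrt{\frac{\ln(4/\delta)}{2n_u}}.$$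
   Context: Setting: $\mathcal{X}\subset\mathbb{R}^d$, marginal density $p(x)$, class-conditional density $p(x\mid y_s)$ for a fixed class $y_s$. The Bregman divergence of $\eta$ between the true ratio $\phi$ and a model $\hat\phi$ is $\mathrm{BR}_\eta(\phi\,\|\,\hat\phi)=\int p(x\mid y_s)\bigl[\eta(\phi(x))-\eta(\hat\phi(x))-\eta'(\hat\phi(x))(\phi(x)-\hat\phi(x))\bigr]dx$, which equals $J_\eta(\hat\phi)-J_\eta(\phi)$ where $J_\eta(\hat\phi)=\int p(x\mid y_s)\eta'(\hat\phi(x))\hat\phi(x)dx-\int p(x\mid y_s)\eta(\hat\phi(x))dx-\int p(x)\eta'(\hat\phi(x))dx$. Its empirical estimator is $\hat J_\eta(\hat\phi)=\frac1n\sum_{i=1}^n\eta'(\hat\phi(x_i))\hat\phi(x_i)-\frac1n\sum_{i=1}^n\eta(\hat\phi(x_i))-\frac1{n_u}\sum_{i=1}^{n_u}\eta'(\hat\phi(x^u_i))$. $\mathfrak{R}_n(\Phi)$ is the Rademacher complexity $\mathbb{E}_Z\mathbb{E}_\sigma[\sup_{f\in\Phi}\frac1n\sum_i\sigma_if(Z_i)]$ with $Z_i$ i.i.d. from $p(x\mid y_s)$; $\mathfrak{R}^u_{n_u}(\Phi)$ is the same with $n_u$ samples i.i.d. from $p(x)$; $\sigma_i$ i.i.d. uniform on $\{-1,+1\}$. *)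

(* Defs.v *)
From HB Require Import structures.
From mathcomp Require Import all_boot all_order all_algebra.
From mathcomp Require Import all_classical all_reals all_analysis measurable_realfun.
Set Implicit Arguments. Unset Strict Implicit. Unset Printing Implicit Defensive.
Import Order.TTheory GRing.Theory Num.Theory.
Import numFieldNormedType.Exports.
Local Open Scope classical_set_scope.
Local Open Scope ring_scope.

Section defs.
Context {R : realType}.

Definition strictly_convex (eta : R -> R) : Prop :=
  forall x y t : R, x != y -> 0 < t < 1 ->
    eta (t * x + (1 - t) * y) < t * eta x + (1 - t) * eta y.

Definition lipschitz_on_sym_interval (C L : R) (g : R -> R) : Prop :=
  forall x y : R, `|x| <= C -> `|y| <= C -> `|g x - g y| <= L * `|x - y|.

Context {d : measure_display} {T : measurableType d}.

Definition sgnb (b : bool) : R := if b then 1 else -1.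

Definition rad_sup (n : nat) (Phi : set (T -> R)) (x : n.-tuple T)
  (s : {ffun 'I_n -> bool}) : \bar R :=
  ereal_sup [set (n%:R^-1 * \sum_(i < n) sgnb (s i) * f (tnth x i))%:E
            | f in Phi].

Definition rademacher (n : nat) (mu : probability (n.-tuple T) R)
  (Phi : set (T -> R)) : \bar R :=
  (\int[mu]_x (((2 ^+ n)%:R^-1 : R)%:E *
     \sum_(s : {ffun 'I_n -> bool}) rad_sup Phi x s))%E.

Definition iid_law (n : nat) (Q : probability T R)
  (mu : probability (n.-tuple T) R) : Prop :=
  forall A : 'I_n -> set T, (forall i, measurable (A i)) ->
    mu [set x | forall i, A i (tnth x i)] = (\prod_(i < n) Q (A i))%E.

Definition sample_law (n nu : nat) (Q P : probability T R)
  (Pr : probability (n.-tuple T * nu.-tuple T)%type R) : Prop :=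
  forall (A : 'I_n -> set T) (B : 'I_nu -> set T),
    (forall i, measurable (A i)) -> (forall j, measurable (B j)) ->
    Pr [set z | (forall i, A i (tnth z.1 i)) /\ (forall j, B j (tnth z.2 j))]
      = ((\prod_(i < n) Q (A i)) * (\prod_(j < nu) P (B j)))%E.

Definition bregman (eta : R -> R) (Q : probability T R) (phi f : T -> R)
  : \bar R :=
  (\int[Q]_x (eta (phi x) - eta (f x) - derive1 eta (f x) * (phi x - f x))%:E)%E.

Definition J_hat (eta : R -> R) (n nu : nat)
  (z : (n.-tuple T * nu.-tuple T)%type) (f : T -> R) : R :=
  n%:R^-1 * \sum_(i < n) derive1 eta (f (tnth z.1 i)) * f (tnth z.1 i)
  - n%:R^-1 * \sum_(i < n) eta (f (tnth z.1 i))
  - nu%:R^-1 * \sum_(j < nu) derive1 eta (f (tnth z.2 j)).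

End defs.

(* Main.v *)
Require Import Defs.
From HB Require Import structures.
From mathcomp Require Import all_boot all_order all_algebra.
From mathcomp Require Import all_classical all_reals all_analysis measurable_realfun.
From mathcomp Require Import ring lra.
Import Order.TTheory GRing.Theory Num.Theory.
Import numFieldNormedType.Exports.
Local Open Scope classical_set_scope.
Local Open Scope ring_scope.

(** The excess risk of an empirical minimizer is a sum of four one-sided
    deviations: those of [+h] and [-h] over the first sample, where
    [h u = eta'(u) u - eta(u)], and those of [+eta'] and [-eta'] over the second
    one.  The mean value theorem makes [h] Lipschitz on [[-C_phi, C_phi]], so it
    suffices to bound, for a Lipschitz [g],
    [sup_f (int g(f) dQ - 1/n sum_i g(f(x_i)))] by the Rademacher complexity.

    The composed class [g o Phi] may have nonmeasurable suprema: only those of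
    [Phi] are assumed measurable.  For fixed [x], the vectors
    [(f(x_1), ..., f(x_n))] lie in the polytope cut out by the [2^n] inequalities
    [1/n sum_i s_i t_i <= rad_sup x s].  This polytope has the same Rademacher
    suprema as the class, so the contraction principle applied to it loses
    nothing; and, after rounding the bounds to a grid, it takes countably many
    values as [x] varies, so suprema of [g] over it are measurable in [x].

    Concentration is obtained from exponential moments: symmetrization with a
    ghost sample gives, for each sign vector, a measurable majorant of the
    exponential of the deviation, then bounded differences are used in the signs
    (pathwise) and in the sample (for the Rademacher average). *)

Set Implicit Arguments.
Unset Strict Implicit.

(** * Bounded measurable functions and their expectations *)

Definition bmeas {R : realType} {d} {X : measurableType d} (f : X -> R) : Prop :=
  measurable_fun setT f /\ exists B : R, forall x, `|f x| <= B.

Section bmeas_closure.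
Context {R : realType} {d : measure_display} {X : measurableType d}.
Implicit Types f g : X -> R.

Lemma bmeas_cst (r : R) : bmeas (fun _ : X => r).
Proof. by split; [exact: measurable_cst | exists `|r|]. Qed.

Lemma bmeasD f g : bmeas f -> bmeas g -> bmeas (fun x => f x + g x).
Proof.
move=> [mf [B fB]] [mg [D gD]]; split; first exact: measurable_funD.
by exists (B + D) => x; rewrite (le_trans (ler_normD _ _))// lerD.
Qed.

Lemma bmeasM f g : bmeas f -> bmeas g -> bmeas (fun x => f x * g x).
Proof.
move=> [mf [B fB]] [mg [D gD]]; split; first exact: measurable_funM.
by exists (B * D) => x; rewrite normrM ler_pM.
Qed.

Lemma bmeasZ (r : R) f : bmeas f -> bmeas (fun x => r * f x).
Proof. exact/bmeasM/bmeas_cst. Qed.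

Lemma bmeasN f : bmeas f -> bmeas (fun x => - f x).
Proof.
by move=> /(bmeasZ (-1)); under eq_fun do rewrite mulN1r.
Qed.

Lemma bmeasB f g : bmeas f -> bmeas g -> bmeas (fun x => f x - g x).
Proof. by move=> bf bg; exact/bmeasD/bmeasN. Qed.

Lemma bmeas_sum (I : Type) (r : seq I) (F : I -> X -> R) :
  (forall i, bmeas (F i)) -> bmeas (fun x => \sum_(i <- r) F i x).
Proof.
move=> bF; elim: r => [|i r IHr].
  by under eq_fun do rewrite big_nil; exact: bmeas_cst.
by under eq_fun do rewrite big_cons; exact: bmeasD.
Qed.

Lemma bmeas_expR f : bmeas f -> bmeas (fun x => expR (f x)).
Proof.
move=> [mf [B fB]]; split; first exact: measurableT_comp.
by exists (expR B) => x; rewrite ger0_norm ?expR_ge0// ler_expR (le_trans (ler_norm _)).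
Qed.

Lemma bmeas_comp {d'} {Y : measurableType d'} (h : Y -> X) f :
  measurable_fun setT h -> bmeas f -> bmeas (fun y => f (h y)).
Proof.
move=> mh [mf [B fB]]; split; first exact: measurableT_comp.
by exists B.
Qed.

End bmeas_closure.

Section bmeas_expectation.
Context {R : realType} {d : measure_display} {X : measurableType d}.
Variable mu : probability X R.
Implicit Types f g : X -> R.

Lemma bmeas_integrable f : bmeas f -> mu.-integrable setT (EFin \o f).
Proof.
move=> [mf [B fB]]; apply: measurable_bounded_integrable => //.
  by rewrite -ge0_fin_numE// fin_num_measure.
exists B; split; first exact: num_real.
by move=> M BM x _; rewrite /= (le_trans (fB x))// ltW.
Qed.

Lemma EFin_Rintegral f : bmeas f -> ((\int[mu]_x f x)%:E = \int[mu]_x (f x)%:E)%E.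
Proof.
by move=> bf; rewrite fineK//; apply: integrable_fin_num => //; exact: bmeas_integrable.
Qed.

Lemma Rintegral_probability_cst (r : R) : \int[mu]_x r = r.
Proof.
rewrite Rintegral_cst// (_ : fine _ = 1) ?mulr1//.
by have /(congr1 fine) := @probability_setT _ _ _ mu.
Qed.

Lemma bmeas_RintegralD f g : bmeas f -> bmeas g ->
  \int[mu]_x (f x + g x) = \int[mu]_x f x + \int[mu]_x g x.
Proof. by move=> bf bg; rewrite RintegralD//; exact: bmeas_integrable. Qed.

Lemma bmeas_RintegralB f g : bmeas f -> bmeas g ->
  \int[mu]_x (f x - g x) = \int[mu]_x f x - \int[mu]_x g x.
Proof. by move=> bf bg; rewrite RintegralB//; exact: bmeas_integrable. Qed.

Lemma bmeas_RintegralZl (r : R) f : bmeas f ->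
  \int[mu]_x (r * f x) = r * \int[mu]_x f x.
Proof. by move=> bf; rewrite RintegralZl//; exact: bmeas_integrable. Qed.

Lemma bmeas_Rintegral_sum (I : Type) (r : seq I) (F : I -> X -> R) :
  (forall i, bmeas (F i)) ->
  \int[mu]_x (\sum_(i <- r) F i x) = \sum_(i <- r) \int[mu]_x F i x.
Proof.
move=> bF; elim: r => [|i r IHr].
  rewrite big_nil -[RHS]Rintegral_probability_cst.
  by apply: eq_Rintegral => x _; rewrite big_nil.
rewrite big_cons -IHr -bmeas_RintegralD//; last exact: bmeas_sum.
by apply: eq_Rintegral => x _; rewrite big_cons.
Qed.

Lemma bmeas_le_Rintegral f g : bmeas f -> bmeas g -> (forall x, f x <= g x) ->
  \int[mu]_x f x <= \int[mu]_x g x.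
Proof. by move=> bf bg fg; apply: le_Rintegral => //; exact: bmeas_integrable. Qed.

Lemma bmeas_Rintegral_le_cst f (r : R) : bmeas f -> (forall x, f x <= r) ->
  \int[mu]_x f x <= r.
Proof.
move=> bf fr; rewrite -[leRHS]Rintegral_probability_cst.
by apply: bmeas_le_Rintegral => //; exact: bmeas_cst.
Qed.

Lemma bmeas_Rintegral_ge_cst f (r : R) : bmeas f -> (forall x, r <= f x) ->
  r <= \int[mu]_x f x.
Proof.
move=> bf fr; rewrite -[leLHS]Rintegral_probability_cst.
by apply: bmeas_le_Rintegral => //; exact: bmeas_cst.
Qed.

Lemma bmeas_Rintegral_norm f (r : R) : bmeas f -> (forall x, `|f x| <= r) ->
  `|\int[mu]_x f x| <= r.
Proof.
move=> bf fr; rewrite ler_norml bmeas_Rintegral_le_cst ?bmeas_Rintegral_ge_cst//.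
- by move=> x; have := fr x; rewrite ler_norml => /andP[].
- by move=> x; have := fr x; rewrite ler_norml => /andP[].
Qed.

(** Jensen's inequality: the tangent line of the exponential at the mean [m] lies below it and has
    expectation [expR m]. *)
Lemma expR_Rintegral_le f : bmeas f ->
  expR (\int[mu]_x f x) <= \int[mu]_x expR (f x).
Proof.
move=> bf; set m := \int[mu]_x f x.
have -> : expR m = \int[mu]_x (expR m * (1 - m + f x)).
  rewrite bmeas_RintegralZl; last exact/bmeasD/bf/bmeas_cst.
  rewrite bmeas_RintegralD//; last exact: bmeas_cst.
  by rewrite Rintegral_probability_cst -/m subrK mulr1.
apply: bmeas_le_Rintegral.
- exact/bmeasZ/bmeasD/bf/bmeas_cst.
- exact: bmeas_expR.
- move=> x; rewrite -[f x in leRHS](subrKC m) expRD ler_pM2l ?expR_gt0//.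
  by rewrite -addrA (addrC (- m)) expR_ge1Dx.
Qed.

Lemma bmeas_markov f (a : R) : bmeas f -> (forall x, 0 <= f x) -> 0 < a ->
  (mu [set x | (a < f x)%R] <= (a^-1 * \int[mu]_x f x)%:E)%E.
Proof.
move=> bf f0 a0; have mA : measurable [set x | a < f x].
  rewrite -[X in measurable X]setTI (_ : [set x | _] = f @^-1` `]a, +oo[%classic).
    by apply: bf.1 => //.
  by apply/seteqP; split => x /=; rewrite in_itv/= andbT.
have bI : bmeas (\1_[set x | a < f x] : X -> R).
  split; first exact: measurable_indic.
  by exists 1 => x; rewrite indicE; case: (_ \in _); rewrite ?normr1 ?normr0.
have -> : mu [set x | a < f x] = (\int[mu]_x (\1_[set x | (a < f x)%R] x)%:E)%E.
  by rewrite integral_indic// setIT.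
rewrite -EFin_Rintegral// lee_fin.
rewrite -bmeas_RintegralZl//; apply: bmeas_le_Rintegral => //; first exact: bmeasZ.
move=> x; rewrite indicE; case: (boolP (x \in _)) => [|_] /=.
  by rewrite inE/= => /ltW afx; rewrite mulrC ler_pdivlMr// mul1r.
by rewrite mulr_ge0// invr_ge0 ltW.
Qed.

End bmeas_expectation.

Lemma bmeas_Rintegral_law {R : realType} {d d' : measure_display}
    {X : measurableType d} {Y : measurableType d'} (mu : probability X R)
    (nu : probability Y R) (h : Y -> X) (f : X -> R) : measurable_fun setT h ->
  (forall A, measurable A -> nu (h @^-1` A) = mu A) ->
  bmeas f -> \int[nu]_y f (h y) = \int[mu]_x f x.
Proof.
move=> mh hA bf; congr fine.
rewrite (eq_measure_integral (pushforward nu h)); last first.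
  by move=> A mA _; rewrite /= /pushforward hA.
have bfh : bmeas (fun y => f (h y)) by exact: bmeas_comp.
have ifh := bmeas_integrable nu bfh.
by rewrite integral_pushforward//; exact/measurable_EFinP/bf.1.
Qed.

Section bmeas_Fubini.
Context {R : realType} {d d' : measure_display}.
Context {X : measurableType d} {Y : measurableType d'}.
Variables (mu : probability X R) (nu : probability Y R) (F : X * Y -> R).
Hypothesis bF : bmeas F.

Lemma bmeas_section x : bmeas (fun y => F (x, y)).
Proof. by apply: bmeas_comp bF; exact: measurable_pair1. Qed.

Let iF : (mu \x nu)%E.-integrable setT (EFin \o F).
Proof. exact: bmeas_integrable. Qed.

Lemma bmeas_Fubini_section : bmeas (fun x => \int[nu]_y F (x, y)).
Proof.
split; last first.
  have [_ [B FB]] := bF; exists B => x.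
  by apply: bmeas_Rintegral_norm => //; exact: bmeas_section.
apply/measurable_EFinP.
rewrite (_ : _ \o _ = fun x => (\int[nu]_y (F (x, y))%:E)%E); last first.
  by apply/funext => x /=; rewrite EFin_Rintegral//; exact: bmeas_section.
exact: (measurable_fubini_F iF).
Qed.

Lemma bmeas_Fubini :
  \int[(mu \x nu)%E]_z F z = \int[mu]_x \int[nu]_y F (x, y).
Proof.
congr fine; rewrite -(integral12_prod_meas1 iF).
apply: eq_integral => x _ /=; rewrite EFin_Rintegral//; exact: bmeas_section.
Qed.

End bmeas_Fubini.

(** * Laws of i.i.d. samples and exchange of coordinates *)

Section tuple_laws.
Context {R : realType} {d : measure_display} {T : measurableType d}.

Definition rectangle (n m : nat) (A : 'I_n -> set T) (B : 'I_m -> set T) :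
    set (n.-tuple T * m.-tuple T) :=
  [set z | (forall i, A i (tnth z.1 i)) /\ (forall j, B j (tnth z.2 j))].

(** Rectangles form a pi-system generating the product sigma-algebra, and [setT] is one of them, so
    they determine a finite measure. *)
Lemma rectangle_law_unique n m (m1 m2 : {measure set (n.-tuple T * m.-tuple T) -> \bar R}) :
  (m1 setT < +oo)%E ->
  (forall A B, (forall i, measurable (A i)) -> (forall j, measurable (B j)) ->
    m1 (rectangle A B) = m2 (rectangle A B)) ->
  forall E, measurable E -> m1 E = m2 E.
Proof.
move=> m1oo m12.
pose G : set (set (n.-tuple T * m.-tuple T)) := [set E | exists A B,
  [/\ forall i, measurable (A i), forall j, measurable (B j) & E = rectangle A B]].
have GT : G setT.
  by exists (fun=> setT), (fun=> setT); split => //; apply/seteqP; split.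
have GI : setI_closed G.
  move=> _ _ [A [B [mA mB ->]]] [A' [B' [mA' mB' ->]]].
  exists (fun i => A i `&` A' i), (fun j => B j `&` B' j).
  split=> [i|j|]; [exact: measurableI|exact: measurableI|].
  by apply/seteqP; split => [z [[a b] [a' b']]|z /= [aa' bb']]; split;
    split=> // i; try have [] := aa' i; try have [] := bb' i.
have mG : measurable = <<s G >>.
  apply/seteqP; split => [E mE|].
    (* Every coordinate projection is measurable for [<<s G >>]: the preimage of [C] is the
       rectangle with side [C] at [i] and [setT] elsewhere. *)
    have mid : measurable_fun setT
        (id : g_sigma_algebraType G -> n.-tuple T * m.-tuple T).
      apply/measurable_fun_pairP; split; apply/measurable_fun_tnthP => i _ C mC.
        rewrite setTI; apply: sub_sigma_algebra.
        exists (fun k => if k == i then C else setT), (fun=> setT); split => //.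
          by move=> k; case: ifP.
        apply/seteqP; split => [z Cz|z [/(_ i)]]/=; last by rewrite eqxx.
        by split=> // k; case: eqP => // ->.
      rewrite setTI; apply: sub_sigma_algebra.
      exists (fun=> setT), (fun k => if k == i then C else setT); split => //.
        by move=> k; case: ifP.
      apply/seteqP; split => [z Cz|z [_ /(_ i)]]/=; last by rewrite eqxx.
      by split=> // k; case: eqP => // ->.
    by have := mid measurableT E mE; rewrite setTI.
  apply: smallest_sub; first exact: sigma_algebra_measurable.
  move=> _ [A [B [mA mB ->]]].
  rewrite (_ : rectangle A B =
    \bigcap_(i in [set: 'I_n]) ((fun z => tnth z.1 i) @^-1` A i) `&`
    \bigcap_(j in [set: 'I_m]) ((fun z => tnth z.2 j) @^-1` B j)).
    apply: measurableI; apply: fin_bigcap_measurable => // i _.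
      rewrite -[X in measurable X]setTI.
      exact: (measurableT_comp (measurable_tnth i) measurable_fst).
    rewrite -[X in measurable X]setTI.
    exact: (measurableT_comp (measurable_tnth i) measurable_snd).
  apply/seteqP; split=> z [a b]; split; [by move=> i _; exact: a|by move=> i _; exact: b| |].
    by move=> i; exact: (a i I).
  by move=> i; exact: (b i I).
apply: (measure_unique G (fun=> setT)) => //.
- by rewrite bigcup_const//; exists 0%N.
- by move=> _ [A [B [mA mB ->]]]; exact: m12.
Qed.

Definition mix n (s : {ffun 'I_n -> bool}) (x x' : n.-tuple T) : n.-tuple T :=
  [tuple if s i then tnth x' i else tnth x i | i < n].

Lemma tnth_mix n (s : {ffun 'I_n -> bool}) (x x' : n.-tuple T) i :
  tnth (mix s x x') i = if s i then tnth x' i else tnth x i.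
Proof. by rewrite tnth_mktuple. Qed.

Lemma measurable_mix n (s : {ffun 'I_n -> bool}) :
  measurable_fun setT (fun z : n.-tuple T * n.-tuple T => mix s z.1 z.2).
Proof.
apply/measurable_fun_tnthP => i.
rewrite (_ : _ \o _ = fun z => if s i then tnth z.2 i else tnth z.1 i); last first.
  by apply/funext => z; exact: tnth_mix.
case: (s i).
  exact: (measurableT_comp (measurable_tnth i) measurable_snd).
exact: (measurableT_comp (measurable_tnth i) measurable_fst).
Qed.

Definition swap_mix n (s : {ffun 'I_n -> bool}) (z : n.-tuple T * n.-tuple T) :=
  (mix s z.1 z.2, mix s z.2 z.1).

Lemma measurable_swap_mix n (s : {ffun 'I_n -> bool}) : measurable_fun setT (swap_mix s).
Proof.
apply: measurable_fun_pair; first exact: measurable_mix.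
exact: (measurableT_comp (measurable_mix s) (@measurable_swap _ _ _ _)).
Qed.

Lemma product_rectangle (Q P : probability T R) n m (mu : probability (n.-tuple T) R)
    (nu : probability (m.-tuple T) R) A B : iid_law Q mu -> iid_law P nu ->
  (forall i, measurable (A i)) -> (forall j, measurable (B j)) ->
  (mu \x nu)%E (rectangle A B) = ((\prod_(i < n) Q (A i)) * (\prod_(j < m) P (B j)))%E.
Proof.
move=> iidmu iidnu mA mB; rewrite -iidmu// -iidnu//.
have m1 k (C : 'I_k -> set T) : (forall i, measurable (C i)) ->
    measurable [set x : k.-tuple T | forall i, C i (tnth x i)].
  move=> mC; rewrite (_ : [set x | _] =
    \bigcap_(i in [set: 'I_k]) ((fun x : k.-tuple T => tnth x i) @^-1` C i)).
    apply: fin_bigcap_measurable => // i _.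
    by rewrite -[X in measurable X]setTI; exact: measurable_tnth.
  by apply/seteqP; split=> [x Cx i _|x Cx i]; [exact: Cx|exact: (Cx i I)].
by rewrite -product_measure1E//; [exact: m1|exact: m1].
Qed.

(** The joint law is given only on rectangles; identifying it with [mu \x nu] makes events about the
    two samples independent. *)
Lemma sample_law_product (Q P : probability T R) n m (mu : probability (n.-tuple T) R)
    (nu : probability (m.-tuple T) R) (Pr : probability (n.-tuple T * m.-tuple T)%type R) :
  iid_law Q mu -> iid_law P nu -> sample_law Q P Pr ->
  forall E, measurable E -> Pr E = (mu \x nu)%E E.
Proof.
move=> iidmu iidnu law; apply: rectangle_law_unique.
  by rewrite -ge0_fin_numE// fin_num_measure.
by move=> A B mA mB; rewrite [RHS](product_rectangle iidmu iidnu)// -law.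
Qed.

(** The preimage of a rectangle is the rectangle with sides [A i] and [B i] exchanged wherever [s i]
    holds; it has the same probability because all coordinates share the law [Q]. *)
Lemma swap_mix_law (Q : probability T R) n (mu : probability (n.-tuple T) R)
    (s : {ffun 'I_n -> bool}) E : iid_law Q mu -> measurable E ->
  (mu \x mu)%E (swap_mix s @^-1` E) = (mu \x mu)%E E.
Proof.
move=> iidmu mE; pose sw : {mfun _ >-> _} := mfun_Sub (mem_set (measurable_swap_mix s)).
apply/esym; apply: (@rectangle_law_unique _ _ _ (pushforward (mu \x mu)%E sw)) => //.
  have mmT : (mu \x mu)%E setT = 1%E by exact: probability_setT.
  by move: mmT => /= ->; rewrite ltry.
move=> A B mA mB; apply/esym.
pose A' i := if s i then B i else A i.
pose B' i := if s i then A i else B i.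
have sE : swap_mix s @^-1` rectangle A B = rectangle A' B'.
  apply/seteqP; split => z [/= a b]; split=> i; move: (a i) (b i);
    by rewrite /A' /B' !tnth_mix; case: (s i).
transitivity ((mu \x mu)%E (swap_mix s @^-1` rectangle A B)); first by [].
rewrite sE [LHS](product_rectangle iidmu iidmu); last 2 first.
- by move=> i; rewrite /A'; case: ifP.
- by move=> i; rewrite /B'; case: ifP.
rewrite [RHS](product_rectangle iidmu iidmu)//.
rewrite -!big_split/=; apply: eq_bigr => i _; rewrite /A' /B'.
by case: (s i) => //; rewrite muleC.
Qed.

Section swap_expectation.
Variables (Q : probability T R) (n : nat) (mu : probability (n.-tuple T) R).
Hypothesis iidmu : iid_law Q mu.

Lemma Rintegral_swap_mix (s : {ffun 'I_n -> bool}) F : bmeas F ->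
  \int[(mu \x mu)%E]_z F (swap_mix s z) = \int[(mu \x mu)%E]_z F z.
Proof.
move=> bF; apply: (@bmeas_Rintegral_law _ _ _ _ _ (mu \x mu)%E (mu \x mu)%E (swap_mix s)) => //.
  exact: measurable_swap_mix.
by move=> A mA; exact: (swap_mix_law s iidmu mA).
Qed.

Lemma Rintegral_mix (s : {ffun 'I_n -> bool}) F : bmeas F ->
  \int[(mu \x mu)%E]_z F (mix s z.1 z.2) = \int[mu]_x F x.
Proof.
move=> bF.
have bF1 : bmeas (fun z : n.-tuple T * n.-tuple T => F z.1) by exact: bmeas_comp.
rewrite (Rintegral_swap_mix s bF1) bmeas_Fubini//=.
by apply: eq_Rintegral => x _; rewrite Rintegral_probability_cst.
Qed.

Lemma Rintegral_mix' (s : {ffun 'I_n -> bool}) F : bmeas F ->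
  \int[(mu \x mu)%E]_z F (mix s z.2 z.1) = \int[mu]_x F x.
Proof.
move=> bF; rewrite -(Rintegral_mix [ffun i => ~~ s i])//.
apply: eq_Rintegral => z _; congr F; apply: eq_from_tnth => i.
by rewrite !tnth_mix ffunE; case: (s i).
Qed.

Lemma Rintegral_tnth i f : bmeas f ->
  \int[mu]_x f (tnth x i) = \int[Q]_x f x.
Proof.
move=> bf; apply: (@bmeas_Rintegral_law _ _ _ _ _ Q mu (fun x => tnth x i)) => //.
  exact: measurable_tnth.
move=> A mA.
have -> : (fun x : n.-tuple T => tnth x i) @^-1` A =
    [set x | forall k, (if k == i then A else setT) (tnth x k)].
  apply/seteqP; split => [x Ax k|x /(_ i)]/=; last by rewrite eqxx.
  by case: eqP => // ->.
transitivity (\prod_(k < n) Q (if k == i then A else setT))%E.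
  by apply: iidmu => k; case: ifP.
rewrite (bigD1 i)//= eqxx big1 ?mule1// => k /negbTE ->.
exact: probability_setT.
Qed.

End swap_expectation.

End tuple_laws.

(** * Exponential moments of functions of random signs *)

Lemma expR_sym_le (R : realType) (u : R) :
  (expR u + expR (- u)) / 2 <= expR (2 * u ^+ 2).
Proof.
have H v : `|v| <= 2 * u ^+ 2 -> expR v <= expR (2 * u ^+ 2).
  by move=> vu; rewrite ler_expR (le_trans (ler_norm _)).
(* The exponent [2 u^2], weaker than the sharp [u^2 / 2], allows an elementary split: if it exceeds
   [1], it also dominates [|u|]; otherwise the left side is at most [1 / (1 - u^2)], which is at
   most [exp (2 u^2)] since [(1 - u^2) (1 + 2 u^2) >= 1]. *)
have [u2|u2] := leP (2 * u ^+ 2) 1; last first.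
  suff uu : `|u| <= 2 * u ^+ 2.
    have := H u uu; have := H (- u); rewrite normrN => /(_ uu).
    by move=> h1 h2; rewrite ler_pdivrMr//; lra.
  rewrite -(real_normK (num_real u)) expr2 mulrA ler_peMl//.
  rewrite leNgt; apply/negP => u1; move: u2.
  rewrite ltNge -(real_normK (num_real u)) => /negP; apply.
  by have := normr_ge0 u; nra.
have u1 : u < 1 by nra.
have u1' : - u < 1 by nra.
have E v : v < 1 -> expR v <= (1 - v)^-1.
  move=> v1; rewrite -[leLHS]invrK lef_pV2 ?posrE ?invr_gt0 ?expR_gt0 ?subr_gt0//.
  by rewrite -expRN expR_ge1Dx.
have D0 : 0 < 1 - u ^+ 2 by nra.
apply: (@le_trans _ _ (1 - u ^+ 2)^-1).
  have -> : (1 - u ^+ 2)^-1 = ((1 - u)^-1 + (1 - - u)^-1) / 2.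
    by field; apply/and3P; split; lra.
  by rewrite ler_pM2r// lerD// E.
rewrite -[leRHS]invrK lef_pV2 ?posrE ?invr_gt0 ?expR_gt0//.
rewrite -expRN.
have := expR_ge1Dx (2 * u ^+ 2); have := expRxMexpNx_1 (2 * u ^+ 2).
have := expR_gt0 (- (2 * u ^+ 2)).
set e := expR (- _); set E' := expR _ => e0 Ee E1.
have u20 : 0 <= u ^+ 2 by exact: sqr_ge0.
have : e * (1 + 2 * u ^+ 2) <= 1 by rewrite -[leRHS]Ee mulrC ler_pM2r.
nra.
Qed.

Section bounded_differences_signs.
Context {R : realType} (n : nat).
Local Notation S := {ffun 'I_n -> bool}.

Definition flip (i : 'I_n) (s : S) : S := [ffun k => if k == i then ~~ s k else s k].

Lemma flipK i : involutive (flip i).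
Proof. by move=> s; apply/ffunP => k; rewrite !ffunE; case: eqP => // _; rewrite negbK. Qed.

Lemma flipC i j s : flip i (flip j s) = flip j (flip i s).
Proof. by apply/ffunP => k; rewrite !ffunE; do 2 case: eqP. Qed.

Lemma sum_flip i (F : S -> R) : \sum_s F (flip i s) = \sum_s F s.
Proof. by rewrite [RHS](reindex_inj (inv_inj (flipK i))). Qed.

(** Go from [s] to [s'] through the hybrids agreeing with [s'] on the first [k] coordinates and with
    [s] on the rest: consecutive hybrids are equal or differ by one flip. *)
Lemma flip_invariant_cst (F : S -> R) :
  (forall i s, F (flip i s) = F s) -> forall s s', F s = F s'.
Proof.
move=> Ff s s'.
suff H k : F [ffun i : 'I_n => if (i < k)%N then s' i else s i] = F s.
  by rewrite -(H n); congr F; apply/ffunP => i; rewrite !ffunE ltn_ord.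
elim: k => [|k IHk]; first by congr F; apply/ffunP => i; rewrite !ffunE.
rewrite -[RHS]IHk; have [nk|kn] := leqP n k.
  by congr F; apply/ffunP => i; rewrite !ffunE ltnS (leq_trans (ltnW (ltn_ord i)))// (leq_trans (ltn_ord i)).
pose i0 := Ordinal kn.
have [ss|ss] := eqVneq (s i0) (s' i0).
  congr F; apply/ffunP => i; rewrite !ffunE ltnS leq_eqVlt.
  case: (eqVneq (i : nat) k) => //= ik; rewrite ik ltnn.
  by have -> : i = i0 by exact: val_inj.
rewrite -[RHS](Ff i0); congr F; apply/ffunP => i; rewrite !ffunE ltnS leq_eqVlt.
rewrite -(inj_eq val_inj) /=; case: (eqVneq (i : nat) k) => //= ik.
have -> : i = i0 by exact: val_inj.
by rewrite /= ltnn; move: ss; case: (s i0); case: (s' i0).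
Qed.

(** The conditional expectation of [F] given all signs but the [i]-th. *)
Definition flip_avg i (F : S -> R) s := (F s + F (flip i s)) / 2.

Lemma sum_flip_avg i F : \sum_s flip_avg i F s = \sum_s F s.
Proof. by rewrite -mulr_suml big_split/= sum_flip; field. Qed.

(** Pair [s] with [flip i s] and factor out the midpoint of the two values: what remains is the
    hyperbolic cosine of half their difference, hence the constant [c^2 / 2]. *)
Lemma expR_flip_avg (c : R) i F : (forall s, `|F s - F (flip i s)| <= c) ->
  \sum_s expR (F s) <= expR (c ^+ 2 / 2) * \sum_s expR (flip_avg i F s).
Proof.
move=> Fc; have -> : \sum_s expR (F s) = \sum_s (expR (F s) + expR (F (flip i s))) / 2.
  by rewrite -mulr_suml big_split/= (sum_flip i (fun s => expR (F s))); field.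
rewrite mulr_sumr; apply: ler_sum => s _; rewrite /flip_avg.
set a := F s; set b := F (flip i s); pose u := (a - b) / 2.
have -> : expR a = expR ((a + b) / 2) * expR u by rewrite -expRD; congr expR; rewrite /u; field.
have -> : expR b = expR ((a + b) / 2) * expR (- u) by rewrite -expRD; congr expR; rewrite /u; field.
rewrite -mulrDr -mulrA mulrC ler_pM2r ?expR_gt0// (le_trans (expR_sym_le u))// ler_expR.
have -> : 2 * u ^+ 2 = (a - b) ^+ 2 / 2 by rewrite /u; field.
rewrite ler_pM2r// -(real_normK (num_real (a - b))) lerXn2r ?nnegrE//.
  exact: le_trans (Fc s).
exact: Fc.
Qed.

(** Signs are averaged out one at a time: the mean and the bound on differences persist, each sign
    costs a factor [exp (c^2 / 2)], and the function left at the end is constant, hence equal to the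
    mean. *)
Lemma expR_bounded_differences_signs (c : R) (F : S -> R) :
  (forall i s, `|F s - F (flip i s)| <= c) ->
  \sum_s expR (F s) <=
  #|S|%:R * expR (n%:R * (c ^+ 2 / 2) + #|S|%:R^-1 * \sum_s F s).
Proof.
move=> Fc.
suff [G [sG Gf _ Gle]] : exists G : S -> R, [/\ \sum_s G s = \sum_s F s,
    forall i s, i \in enum 'I_n -> G (flip i s) = G s,
    forall i s, `|G s - G (flip i s)| <= c &
    \sum_s expR (F s) <= expR ((size (enum 'I_n))%:R * (c ^+ 2 / 2)) * \sum_s expR (G s)].
  have Gc : forall s s', G s = G s'.
    by apply: flip_invariant_cst => i s; rewrite Gf// mem_enum.
  pose s0 : S := [ffun=> true].
  have N0 : #|S|%:R != 0 :> R by rewrite pnatr_eq0 -lt0n; apply/card_gt0P; exists s0.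
  have -> : #|S|%:R^-1 * \sum_s F s = G s0.
    rewrite -sG (eq_bigr (fun=> G s0)) => [|s _]; last exact: Gc.
    by rewrite sumr_const -(mulr_natr (G s0)) mulrCA mulVf ?mulr1.
  rewrite (le_trans Gle)// size_enum_ord expRD [leRHS]mulrCA ler_pM2l ?expR_gt0//.
  rewrite (eq_bigr (fun=> expR (G s0))) => [|s _]; last by rewrite (Gc s s0).
  by rewrite sumr_const -(mulr_natl (expR _)).
elim: (enum 'I_n) => [|i l [G [sG Gf Gc Gle]]].
  by exists F; split => //; rewrite mul0r expR0 mul1r.
exists (flip_avg i G); split.
- by rewrite sum_flip_avg.
- move=> j s; rewrite inE => /predU1P[->|jl]; rewrite /flip_avg.
    by rewrite flipK addrC.
  by rewrite Gf// flipC Gf.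
- move=> j s; rewrite /flip_avg flipC.
  rewrite (_ : _ - _ = ((G s - G (flip j s)) + (G (flip i s) - G (flip j (flip i s)))) / 2);
    last by field.
  rewrite normrM (@ger0_norm _ 2^-1)// ler_pdivrMr// (le_trans (ler_normD _ _))//.
  by rewrite (_ : c * 2 = c + c) ?lerD ?Gc//; ring.
- rewrite (le_trans Gle)//= -(natr1 (size l)) mulrDl mul1r expRD -[leRHS]mulrA ler_pM2l ?expR_gt0//.
  exact: expR_flip_avg.
Qed.

End bounded_differences_signs.

(** * Suprema of signed sums and the contraction principle *)

Section sign_sup.
Context {R : realType} (n : nat).
Local Notation S := {ffun 'I_n -> bool}.
Variable K : set ('I_n -> R).

(** An unnormalized Rademacher supremum over a set of vectors; [h] may depend on the coordinate so
    that contraction can treat one coordinate at a time. *)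
Definition sign_sup (h : 'I_n -> R -> R) (s : S) : R :=
  sup [set \sum_i sgnb (s i) * h i (t i) | t in K].

Hypothesis K0 : K !=set0.
Variables (M : R) (h : 'I_n -> R -> R).

Lemma sign_sup_le (s : S) r : (forall t, K t -> \sum_i sgnb (s i) * h i (t i) <= r) ->
  sign_sup h s <= r.
Proof.
move=> hr; apply: ge_sup.
  by case: K0 => t Kt; exists (\sum_i sgnb (s i) * h i (t i)), t.
by move=> _ [t Kt <-]; exact: hr.
Qed.

Hypothesis hM : forall t i, K t -> `|h i (t i)| <= M.

Lemma sign_sum_norm_le (s : S) t : K t -> `|\sum_i sgnb (s i) * h i (t i)| <= n%:R * M.
Proof.
move=> Kt; rewrite (le_trans (ler_norm_sum _ _ _))//.
have -> : n%:R * M = \sum_(i < n) M by rewrite sumr_const card_ord mulr_natl.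
apply: ler_sum => i _; rewrite normrM /sgnb.
by case: (s i); rewrite ?normrN normr1 mul1r hM.
Qed.

Lemma sign_sup_ge (s : S) t : K t -> \sum_i sgnb (s i) * h i (t i) <= sign_sup h s.
Proof.
move=> Kt; apply: sup_upper_bound; last by exists t.
split; first by exists (\sum_i sgnb (s i) * h i (t i)), t.
by exists (n%:R * M) => _ [t' Kt' <-]; rewrite (le_trans (ler_norm _))// sign_sum_norm_le.
Qed.

Lemma sign_sup_norm_le (s : S) : `|sign_sup h s| <= n%:R * M.
Proof.
rewrite ler_norml; apply/andP; split; last first.
  by apply: sign_sup_le => t Kt; rewrite (le_trans (ler_norm _))// sign_sum_norm_le.
have [t Kt] := K0; apply: (le_trans _ (sign_sup_ge s Kt)).
by have := sign_sum_norm_le s Kt; rewrite ler_norml => /andP[].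
Qed.

Lemma sign_sup_flip_le i (s : S) : sign_sup h s <= sign_sup h (flip i s) + 2 * M.
Proof.
apply: sign_sup_le => t Kt.
have := sign_sup_ge (flip i s) Kt.
have := hM i Kt; rewrite ler_norml => /andP[].
rewrite !(@bigD1 _ _ _ _ i xpredT)//= ffunE eqxx.
rewrite (eq_bigr (fun j => sgnb (s j) * h j (t j))); last first.
  by move=> j ji; rewrite ffunE (negbTE ji).
by rewrite /sgnb; case: (s i) => /=; lra.
Qed.

Lemma sign_sup_flip i (s : S) : `|sign_sup h s - sign_sup h (flip i s)| <= 2 * M.
Proof.
have := sign_sup_flip_le i s; have := sign_sup_flip_le i (flip i s).
by rewrite flipK ler_norml; lra.
Qed.

End sign_sup.

Section sign_sup_contraction.
Context {R : realType} (n : nat).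
Local Notation S := {ffun 'I_n -> bool}.
Variables (K : set ('I_n -> R)) (g : R -> R) (L M : R).
Hypothesis K0 : K !=set0.
Hypothesis gM : forall t i, K t -> `|g (t i)| <= M.
Hypothesis LM : forall t i, K t -> `|L * t i| <= M.
Hypothesis gL : forall t t' i, K t -> K t' -> `|g (t i) - g (t' i)| <= L * `|t i - t' i|.

(** Interpolates between [g] and the linear map: the coordinates in [l] have already been
    replaced. *)
Let h_ (l : seq 'I_n) i u := if i \in l then L * u else g u.

Let adm_h l t i : K t -> `|h_ l i (t i)| <= M.
Proof. by move=> Kt; rewrite /h_; case: ifP => _; [exact: LM|exact: gM]. Qed.

Lemma sign_sup_contraction_step l k :
  \sum_s sign_sup K (h_ l) s <= \sum_s sign_sup K (h_ (k :: l)) s.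
Proof.
have [kl|kl] := boolP (k \in l).
  apply: ler_sum => s _; apply: sign_sup_le => // t Kt.
  have -> : \sum_i sgnb (s i) * h_ l i (t i) = \sum_i sgnb (s i) * h_ (k :: l) i (t i).
    apply: eq_bigr => i _; rewrite /h_ inE.
    by case: eqP => [->|_] //=; rewrite kl.
  by apply: sign_sup_ge Kt; exact: adm_h.
(* Only the pairs [s, flip k s] can be compared: for each of the two signs of
   [t k - t' k], the Lipschitz bound matches one assignment of [t], [t'] to them. *)
suff H s : sign_sup K (h_ l) s + sign_sup K (h_ l) (flip k s) <=
    sign_sup K (h_ (k :: l)) s + sign_sup K (h_ (k :: l)) (flip k s).
  have : \sum_s (sign_sup K (h_ l) s + sign_sup K (h_ l) (flip k s)) <=
      \sum_s (sign_sup K (h_ (k :: l)) s + sign_sup K (h_ (k :: l)) (flip k s)).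
    exact: ler_sum.
  rewrite !big_split/= !(sum_flip k (fun s => sign_sup K _ s)); lra.
set X := leRHS.
pose A t := \sum_(i | i != k) sgnb (s i) * h_ l i (t i).
have El t s' : s' = s \/ s' = flip k s ->
    \sum_i sgnb (s' i) * h_ l i (t i) = sgnb (s' k) * g (t k) + A t.
  move=> s's; rewrite (bigD1 k)//= {1}/h_ (negbTE kl); congr (_ + _).
  apply: eq_bigr => i ik; case: s's => ->//.
  by rewrite ffunE (negbTE ik).
have Ekl t s' : s' = s \/ s' = flip k s ->
    \sum_i sgnb (s' i) * h_ (k :: l) i (t i) = sgnb (s' k) * (L * t k) + A t.
  move=> s's; rewrite (bigD1 k)//= {1}/h_ inE eqxx; congr (_ + _).
  apply: eq_bigr => i ik; rewrite /h_ inE (negbTE ik)/=; case: s's => ->//.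
  by rewrite ffunE (negbTE ik).
have key t t' : K t -> K t' -> \sum_i sgnb (s i) * h_ l i (t i) +
    \sum_i sgnb (flip k s i) * h_ l i (t' i) <= X.
  move=> Kt Kt'; rewrite !El; [|by right|by left].
  have := sign_sup_ge (@adm_h (k :: l)) s Kt.
  have := sign_sup_ge (@adm_h (k :: l)) s Kt'.
  have := sign_sup_ge (@adm_h (k :: l)) (flip k s) Kt.
  have := sign_sup_ge (@adm_h (k :: l)) (flip k s) Kt'.
  rewrite !Ekl; [|by left|by left|by right|by right].
  rewrite ffunE eqxx -/X /X.
  have := gL k Kt Kt'; rewrite /sgnb.
  have [tt|tt] := leP 0 (t k - t' k).
    rewrite (ger0_norm tt) ler_norml => /andP[].
    by case: (s k) => /=; lra.
  rewrite (ltr0_norm tt) ler_norml => /andP[].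
  by case: (s k) => /=; lra.
(* The two suprema are taken in turn: over [t] for fixed [t'], then over [t']. *)
have : sign_sup K (h_ l) (flip k s) <= X - sign_sup K (h_ l) s.
  apply: sign_sup_le => // t' Kt'.
  have : sign_sup K (h_ l) s <= X - \sum_i sgnb (flip k s i) * h_ l i (t' i).
    by apply: sign_sup_le => // t Kt; have := key _ _ Kt Kt'; lra.
  lra.
lra.
Qed.

(** The Ledoux-Talagrand contraction principle for suprema without absolute values, obtained by
    replacing the coordinates successively along an enumeration. *)
Lemma sign_sup_contraction : \sum_s sign_sup K (fun=> g) s <= \sum_s sign_sup K (fun _ u => L * u) s.
Proof.
have -> : sign_sup K (fun=> g) = sign_sup K (h_ [::]) by [].
have -> : sign_sup K (fun _ u => L * u) = sign_sup K (h_ (enum 'I_n)).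
  by congr (sign_sup K); apply/funext => i; apply/funext => u; rewrite /h_ mem_enum.
elim: (enum 'I_n) => // k l IHl; exact: le_trans (sign_sup_contraction_step l k).
Qed.

End sign_sup_contraction.

(** * Exponential moments of functions of an i.i.d. sample *)

Section bounded_differences.
Context {R : realType} {d : measure_display} {T : measurableType d}.
Variables (Q : probability T R) (n : nat) (mu : probability (n.-tuple T) R).
Hypothesis iidmu : iid_law Q mu.
Implicit Types F : n.-tuple T -> R.

Definition eq_except (i : 'I_n) (x y : n.-tuple T) :=
  forall k, k != i -> tnth x k = tnth y k.

Definition bounded_differences (c : R) F :=
  forall i x y, eq_except i x y -> `|F x - F y| <= c.

Definition pick1 (i : 'I_n) : {ffun 'I_n -> bool} := [ffun k => k == i].

Definition resample (i : 'I_n) (x y : n.-tuple T) := mix (pick1 i) x y.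

(** The conditional expectation of [F] given all coordinates but the [i]-th. Integrating over a
    whole ghost sample [y], of which only the [i]-th entry matters, lets the exchange of coordinates
    under [mu \x mu] apply. *)
Definition coord_avg i F x := \int[mu]_y F (resample i x y).

Lemma eq_except_resample i x y : eq_except i x (resample i x y).
Proof. by move=> k ki; rewrite tnth_mix ffunE (negbTE ki). Qed.

Lemma resample_eq_except i j x x' y : eq_except j x x' ->
  eq_except j (resample i x y) (resample i x' y).
Proof. by move=> xx' k kj; rewrite !tnth_mix ffunE; case: eqP => // _; exact: xx'. Qed.

Lemma resample_eq i x x' y : eq_except i x x' -> resample i x y = resample i x' y.
Proof.
move=> xx'; apply: eq_from_tnth => k; rewrite !tnth_mix ffunE.
by case: eqVneq => // ki; exact: xx'.
Qed.

Lemma bmeas_resample i F : bmeas F -> bmeas (fun z => F (resample i z.1 z.2)).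
Proof. by move=> bF; apply: bmeas_comp bF; exact: measurable_mix. Qed.

Lemma bmeas_resample_section i F x : bmeas F -> bmeas (fun y => F (resample i x y)).
Proof. by move=> /(bmeas_resample i) bF; exact: (bmeas_section bF x). Qed.

Lemma bmeas_coord_avg i F : bmeas F -> bmeas (coord_avg i F).
Proof. by move=> /(bmeas_resample i) bF; exact: (bmeas_Fubini_section mu mu bF). Qed.

Lemma Rintegral_coord_avg i F : bmeas F ->
  \int[mu]_x coord_avg i F x = \int[mu]_x F x.
Proof.
by move=> bF; rewrite -(Rintegral_mix iidmu (pick1 i) bF) bmeas_Fubini//; exact: bmeas_resample.
Qed.

Lemma coord_avg_indep i F x x' : eq_except i x x' -> coord_avg i F x = coord_avg i F x'.
Proof.
by move=> xx'; apply: eq_Rintegral => y _; rewrite (resample_eq _ xx').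
Qed.

Lemma coord_avg_indep_preserved i j F :
  (forall x x', eq_except j x x' -> F x = F x') ->
  forall x x', eq_except j x x' -> coord_avg i F x = coord_avg i F x'.
Proof.
move=> Fj x x' xx'; apply: eq_Rintegral => y _; apply: Fj.
exact: resample_eq_except.
Qed.

Lemma bounded_differences_coord_avg c i F : bmeas F ->
  bounded_differences c F -> bounded_differences c (coord_avg i F).
Proof.
move=> bF Fc j x x' xx'; rewrite /coord_avg -bmeas_RintegralB; last 2 first.
- exact: bmeas_resample_section.
- exact: bmeas_resample_section.
apply: bmeas_Rintegral_norm.
  by apply: bmeasB; exact: bmeas_resample_section.
by move=> y; apply: (Fc j); exact: resample_eq_except.
Qed.

(** Jensen's inequality over the redrawn coordinate introduces the factor [expR (Y - Y')]; by
    symmetry the sign of [Y - Y'] can be averaged, which leaves a hyperbolic cosine with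
    [|Y - Y'| <= c]. *)
Lemma expR_coord_avg c i F : bmeas F -> bounded_differences c F ->
  \int[mu]_x expR (F x) <= expR (2 * c ^+ 2) * \int[mu]_x expR (coord_avg i F x).
Proof.
move=> bF Fc; set B := coord_avg i F.
have bB : bmeas B by exact: bmeas_coord_avg.
pose Y (z : n.-tuple T * n.-tuple T) := F z.1.
pose Y' (z : n.-tuple T * n.-tuple T) := F (resample i z.1 z.2).
have bY : bmeas Y by exact: bmeas_comp.
have bY' : bmeas Y' by exact: bmeas_resample.
have bB1 : bmeas (fun z : n.-tuple T * n.-tuple T => B z.1) by exact: bmeas_comp.
pose G z := expR (B z.1) * expR (Y z - Y' z).
pose G' z := expR (B z.1) * expR (Y' z - Y z).
have bG : bmeas G by apply: bmeasM; apply: bmeas_expR => //; exact: bmeasB.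
have bG' : bmeas G' by apply: bmeasM; apply: bmeas_expR => //; exact: bmeasB.
have H1 : \int[mu]_x expR (F x) <= \int[(mu \x mu)%E]_z G z.
  rewrite bmeas_Fubini//; apply: bmeas_le_Rintegral; first exact: bmeas_expR.
    exact: bmeas_Fubini_section.
  move=> x; rewrite /G /Y /Y' /=.
  under eq_Rintegral do rewrite expRD mulrA.
  rewrite bmeas_RintegralZl; last first.
    by apply/bmeas_expR/bmeasN; exact: bmeas_resample_section.
  rewrite -expRD -ler_pdivrMl ?expR_gt0// -expRN -expRD opprD subrK.
  have := @expR_Rintegral_le _ _ _ mu (fun y => - F (resample i x y)).
  rewrite (_ : \int[mu]_y - F (resample i x y) = - B x); last first.
    under eq_Rintegral do rewrite -mulN1r.
    by rewrite bmeas_RintegralZl ?mulN1r//; exact: bmeas_resample_section.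
  by apply; apply: bmeasN; exact: bmeas_resample_section.
(* Exchanging the [i]-th coordinates of [z.1] and [z.2] exchanges [Y] and [Y']. *)
have H2 : \int[(mu \x mu)%E]_z G z = \int[(mu \x mu)%E]_z G' z.
  rewrite -(Rintegral_swap_mix iidmu (pick1 i) bG).
  apply: eq_Rintegral => z _; rewrite /G /G' /Y /Y' /=; congr (expR _ * expR (F _ - F _)).
    by apply/esym/coord_avg_indep; exact: eq_except_resample.
  apply: eq_from_tnth => k; rewrite !tnth_mix !ffunE.
  by case: eqP.
have H3 : \int[(mu \x mu)%E]_z G z <=
    \int[(mu \x mu)%E]_z (expR (2 * c ^+ 2) * expR (B z.1)).
  have -> : \int[(mu \x mu)%E]_z G z = \int[(mu \x mu)%E]_z (2^-1 * (G z + G' z)).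
    rewrite bmeas_RintegralZl; last exact: bmeasD.
    by rewrite bmeas_RintegralD// -H2; field.
  apply: bmeas_le_Rintegral; [exact/bmeasZ/bmeasD|exact/bmeasZ/bmeas_expR|].
  move=> z; rewrite /G /G' -mulrDr mulrCA mulrC ler_pM2r ?expR_gt0//.
  rewrite -[Y' z - Y z]opprB mulrC (le_trans (expR_sym_le _))// ler_expR ler_pM2l//.
  rewrite -(real_normK (num_real (Y z - Y' z))).
  have Yc : `|Y z - Y' z| <= c by apply: (Fc i); exact: eq_except_resample.
  by rewrite lerXn2r ?nnegrE// (le_trans _ Yc).
rewrite (le_trans H1)// (le_trans H3)// bmeas_RintegralZl; last exact: bmeas_expR.
rewrite ler_pM2l ?expR_gt0//.
have bE : bmeas (fun z : n.-tuple T * n.-tuple T => expR (B z.1)) by exact: bmeas_expR.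
rewrite bmeas_Fubini//=.
by under eq_Rintegral do rewrite Rintegral_probability_cst.
Qed.

Lemma indep_cst (F : n.-tuple T -> R) :
  (forall i x x', eq_except i x x' -> F x = F x') -> forall x x', F x = F x'.
Proof.
move=> Fi x x'.
suff H k : F (mix [ffun i : 'I_n => (i < k)%N] x x') = F x.
  rewrite -(H n); congr F; apply: eq_from_tnth => i.
  by rewrite tnth_mix ffunE ltn_ord.
elim: k => [|k IHk].
  by congr F; apply: eq_from_tnth => i; rewrite tnth_mix ffunE.
rewrite -[RHS]IHk; have [nk|kn] := leqP n k.
  congr F; apply: eq_from_tnth => i; rewrite !tnth_mix !ffunE.
  by rewrite ltnS (leq_trans (ltnW (ltn_ord i)))// (leq_trans (ltn_ord i)).
apply: (Fi (Ordinal kn)) => i ik; rewrite !tnth_mix !ffunE ltnS leq_eqVlt.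
by move: ik; rewrite -(inj_eq val_inj) => /= /negbTE ->.
Qed.

(** Coordinates are averaged out one at a time, as for signs. Each costs [2 c^2] rather than
    [c^2 / 2], since the symmetrized difference is bounded by [c] and not by [c / 2]. *)
Lemma expR_bounded_differences c F : bmeas F -> bounded_differences c F ->
  \int[mu]_x expR (F x) <= expR (n%:R * (2 * c ^+ 2) + \int[mu]_x F x).
Proof.
move=> bF Fc.
suff [G [bG sG Gi _ Gle]] : exists G : n.-tuple T -> R, [/\ bmeas G,
    \int[mu]_x G x = \int[mu]_x F x,
    forall i, i \in enum 'I_n -> forall x x', eq_except i x x' -> G x = G x',
    bounded_differences c G &
    \int[mu]_x expR (F x) <=
      expR ((size (enum 'I_n))%:R * (2 * c ^+ 2)) * \int[mu]_x expR (G x)].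
  have Gc x : G x = G point by apply: indep_cst => i; apply: Gi; rewrite mem_enum.
  rewrite (le_trans Gle)// size_enum_ord expRD ler_pM2l ?expR_gt0// -sG.
  under eq_Rintegral do rewrite Gc.
  under [X in _ <= expR X]eq_Rintegral do rewrite Gc.
  by rewrite !Rintegral_probability_cst.
elim: (enum 'I_n) => [|i l [G [bG sG Gi Gc Gle]]].
  by exists F; split => //; rewrite mul0r expR0 mul1r.
exists (coord_avg i G); split.
- exact: bmeas_coord_avg.
- by rewrite Rintegral_coord_avg.
- move=> j; rewrite inE => /predU1P[->|jl]; first exact: coord_avg_indep.
  by apply: coord_avg_indep_preserved; exact: Gi.
- exact: bounded_differences_coord_avg.
- rewrite (le_trans Gle)//= -(natr1 (size l)) (mulrDl (size l)%:R) mul1r expRD -[leRHS]mulrA.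
  by rewrite ler_pM2l ?expR_gt0//; exact: expR_coord_avg.
Qed.

End bounded_differences.

(** * Rademacher suprema of the class on one sample *)

Section deviation.
Context {R : realType} {d : measure_display} {T : measurableType d}.
Variables (Q : probability T R) (n : nat) (mu : probability (n.-tuple T) R).
Local Notation S := {ffun 'I_n -> bool}.
Local Notation N := (#|S|%:R : R).
Variables (Phi : set (T -> R)) (f0 : T -> R) (C : R).
Hypotheses (n0 : (0 < n)%N) (iidmu : iid_law Q mu).
Hypothesis PhiC : forall f, Phi f -> forall x, `|f x| <= C.
Hypothesis Phif0 : Phi f0.
Hypothesis mrad : forall s, measurable_fun setT (fun x : n.-tuple T => rad_sup Phi x s).

Definition rad_avg (f : T -> R) (x : n.-tuple T) (s : S) : R :=
  n%:R^-1 * \sum_(i < n) sgnb (s i) * f (tnth x i).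

(** The extended supremum is finite because the class contains [f0] and is bounded by [C]. *)
Definition rad_sup_real (s : S) (x : n.-tuple T) : R := fine (rad_sup Phi x s).
Local Notation v := rad_sup_real.

Let nR0 : 0 < n%:R :> R. Proof. by rewrite ltr0n. Qed.

Let N0 : 0 < N.
Proof. by rewrite ltr0n; apply/card_gt0P; exists [ffun=> true]. Qed.

Let nV : `|n%:R^-1 : R| = n%:R^-1. Proof. by rewrite gtr0_norm// invr_gt0. Qed.

Let NV : `|N^-1| = N^-1. Proof. by rewrite gtr0_norm// invr_gt0. Qed.

Let C0 : 0 <= C. Proof. exact: le_trans (normr_ge0 _) (PhiC Phif0 point). Qed.

Lemma rad_avg_norm f x s : Phi f -> `|rad_avg f x s| <= C.
Proof.
move=> Pf; rewrite normrM nV ler_pdivrMl//.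
rewrite (le_trans (ler_norm_sum _ _ _))//.
have -> : n%:R * C = \sum_(i < n) C by rewrite sumr_const card_ord mulr_natl.
apply: ler_sum => i _; rewrite normrM /sgnb.
by case: (s i); rewrite ?normrN normr1 mul1r PhiC.
Qed.

Lemma rad_supE x s : rad_sup Phi x s = (v s x)%:E.
Proof.
rewrite /v fineK// fin_numElt; apply/andP; split.
  apply: (@lt_le_trans _ _ (rad_avg f0 x s)%:E); first exact: ltNyr.
  by apply: ereal_sup_ubound; exists f0.
apply: (@le_lt_trans _ _ C%:E); last exact: ltry.
apply: ge_ereal_sup => _ [f Pf <-]; rewrite lee_fin.
by rewrite (le_trans (ler_norm _))//; exact: rad_avg_norm.
Qed.

Lemma rad_avg_le f x s : Phi f -> rad_avg f x s <= v s x.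
Proof. by move=> Pf; rewrite -lee_fin -rad_supE; apply: ereal_sup_ubound; exists f. Qed.

Lemma rad_sup_real_le s x r : (forall f, Phi f -> rad_avg f x s <= r) -> v s x <= r.
Proof.
move=> fr; rewrite -lee_fin -rad_supE; apply: ge_ereal_sup => _ [f Pf <-].
by rewrite lee_fin; exact: fr.
Qed.

Lemma bmeas_rad_sup_real s : bmeas (v s).
Proof.
split; first exact: (measurableT_comp (fine_measurable measurableT) (mrad s)).
exists C => x; rewrite ler_norml; apply/andP; split.
  apply: (le_trans _ (rad_avg_le x s Phif0)).
  by have := rad_avg_norm x s Phif0; rewrite ler_norml => /andP[].
by apply: rad_sup_real_le => f Pf; rewrite (le_trans (ler_norm _))//; exact: rad_avg_norm.
Qed.

(** Changing one sample point moves each signed average by at most [2 C / n], hence also their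
    supremum. *)
Lemma bounded_differences_rad_sup_real s : bounded_differences (2 * C / n%:R) (v s).
Proof.
have H i x y : eq_except i x y -> v s x <= v s y + 2 * C / n%:R.
  move=> xy; apply: rad_sup_real_le => f Pf.
  have := rad_avg_le y s Pf; rewrite -subr_ge0 => yv.
  rewrite -lerBlDl -subr_ge0 in yv *.
  suff : rad_avg f x s <= rad_avg f y s + 2 * C / n%:R.
    by have := rad_avg_le y s Pf; lra.
  rewrite /rad_avg (mulrC _ n%:R^-1) -mulrDr ler_pM2l ?invr_gt0//.
  rewrite !(@bigD1 _ _ _ _ i xpredT)//=.
  rewrite (eq_bigr (fun j => sgnb (s j) * f (tnth y j))); last first.
    by move=> j ji; rewrite xy.
  have := PhiC Pf (tnth x i); have := PhiC Pf (tnth y i).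
  rewrite !ler_norml /sgnb; case: (s i) => /andP[? ?] /andP[? ?]; lra.
move=> i x y xy; have := H i x y xy.
have := H i y x; move=> /(_ (fun k ki => esym (xy k ki))).
by rewrite ler_norml; lra.
Qed.

(** The empirical Rademacher complexity of the class at [x]. *)
Definition rad_mean (x : n.-tuple T) : R := N^-1 * \sum_s v s x.

Lemma bmeas_rad_mean : bmeas rad_mean.
Proof. by apply/bmeasZ/bmeas_sum => s; exact: bmeas_rad_sup_real. Qed.

Lemma bounded_differences_rad_mean : bounded_differences (2 * C / n%:R) rad_mean.
Proof.
move=> i x y xy; rewrite /rad_mean -mulrBr -sumrB normrM NV.
rewrite ler_pdivrMl// (le_trans (ler_norm_sum _ _ _))//.
have -> : N * (2 * C / n%:R) = \sum_(s : S) (2 * C / n%:R) by rewrite sumr_const mulr_natl.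
by apply: ler_sum => s _; exact: (bounded_differences_rad_sup_real s xy).
Qed.

Lemma rademacherE : rademacher mu Phi = (\int[mu]_x rad_mean x)%:E.
Proof.
rewrite EFin_Rintegral; last exact: bmeas_rad_mean.
apply: eq_integral => x _; rewrite /rad_mean EFinM card_ffun card_bool card_ord.
rewrite -sumEFin; congr (_ * _)%E.
by apply: eq_bigr => s _; rewrite rad_supE.
Qed.

(** * A measurable envelope for the composed class *)

Variables (g : R -> R) (L eps : R).
Hypothesis L0 : 0 < L.
Hypothesis eps0 : 0 < eps.
Hypothesis gL : forall u w, `|u| <= C -> `|w| <= C -> `|g u - g w| <= L * `|u - w|.
Hypothesis gC : forall u, `|u| <= C -> `|g u| <= L * C.
Hypothesis mgPhi : forall f, Phi f -> measurable_fun setT (fun x => g (f x)).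

Definition rounding (x : n.-tuple T) : {ffun S -> int} :=
  [ffun s => Num.floor (v s x / eps)].

(** Because of the [+ 1], the rounded bounds lie above the true ones, so rounding only enlarges the
    polytope, by at most [eps] in each bound. *)
Definition rounded (m : {ffun S -> int}) (s : S) : R := eps * ((m s)%:~R + 1).

Lemma rounded_ge x s : v s x <= rounded (rounding x) s.
Proof.
rewrite /rounded ffunE mulrC -ler_pdivrMr// ltW//.
by have := floorD1_gt (v s x / eps); rewrite intrD.
Qed.

Lemma rounded_le x s : rounded (rounding x) s <= v s x + eps.
Proof.
rewrite /rounded ffunE mulrDr mulr1 lerD2r mulrC -ler_pdivlMr//.
exact: floor_le_tmp.
Qed.

(* [envelope (rounding x)] is a polytope containing the value vectors of the class
   at [x]; [rounding] being countable-valued, suprema over it are measurable in [x]. *)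
Definition envelope (m : {ffun S -> int}) : set ('I_n -> R) :=
  [set t | (forall i, `|t i| <= C) /\
    forall s : S, n%:R^-1 * \sum_i sgnb (s i) * t i <= rounded m s].

Lemma envelope_values f x : Phi f -> envelope (rounding x) (fun i => f (tnth x i)).
Proof.
move=> Pf; split=> [i|s]; first exact: PhiC.
exact: le_trans (rad_avg_le x s Pf) (rounded_ge x s).
Qed.

Let envelope0 x : envelope (rounding x) !=set0.
Proof. by eexists; exact: (envelope_values x Phif0). Qed.

Let envelope_g m t i : envelope m t -> `|g (t i)| <= L * C.
Proof. by move=> [tC _]; exact: gC. Qed.

Definition env_sup (s : S) (x : n.-tuple T) : R :=
  n%:R^-1 * sign_sup (envelope (rounding x)) (fun=> g) s.
Local Notation W := env_sup.

Lemma env_sup_ge f x s : Phi f -> rad_avg (fun y => g (f y)) x s <= W s x.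
Proof.
move=> Pf; rewrite /rad_avg /W ler_pM2l ?invr_gt0//.
exact: (sign_sup_ge (h := fun=> g) (@envelope_g _) s (envelope_values x Pf)).
Qed.

Lemma measurable_rounding m : measurable [set x | rounding x = m].
Proof.
rewrite (_ : [set x | _] = \bigcap_(s in [set: S])
    (v s @^-1` [set y | Num.floor (y / eps) = m s])).
  apply: fin_bigcap_measurable => // s _.
  rewrite -[X in measurable X]setTI; apply: (bmeas_rad_sup_real s).1 => //.
  rewrite (_ : [set y | _] = `[eps * (m s)%:~R, eps * (m s + 1)%:~R[%classic)//.
  apply/seteqP; split=> y /=; rewrite in_itv/= !(mulrC eps) -ler_pdivlMr// -ltr_pdivrMr//.
    by move=> <-; rewrite floor_le_tmp floorD1_gt.
  by move=> h; apply/floor_def.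
apply/seteqP; split => [x <- s _|x xm] /=; first by rewrite ffunE.
by apply/ffunP => s; rewrite ffunE xm.
Qed.

Lemma bmeas_env_sup s : bmeas (W s).
Proof.
split; last first.
  exists (L * C) => x; rewrite normrM nV ler_pdivrMl//.
  by apply: sign_sup_norm_le => // t i; exact: envelope_g.
move=> _ Y mY; rewrite setTI.
(* On each level set of [rounding] the function is constant, so a preimage is a countable union of
   such level sets. *)
rewrite (_ : _ @^-1` _ = \bigcup_m ([set x | rounding x = m] `&`
    [set _ | Y (n%:R^-1 * sign_sup (envelope m) (fun=> g) s)])); last first.
  apply/seteqP; split => [x Yx|x [m _ [/= <-]]]//=.
  by exists (rounding x).
apply: countable_bigcupT_measurable; first exact: countableP.
move=> m; apply: measurableI; first exact: measurable_rounding.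
have [Ym|Ym] := pselect (Y (n%:R^-1 * sign_sup (envelope m) (fun=> g) s)).
  by rewrite (_ : [set _ | _] = setT)//; apply/seteqP; split.
by rewrite (_ : [set _ | _] = set0)//; apply/seteqP; split.
Qed.

Lemma env_sup_flip i s x : `|W s x - W (flip i s) x| <= 2 * (L * C) / n%:R.
Proof.
rewrite /W -mulrBr normrM nV [leRHS]mulrC ler_pM2l ?invr_gt0//.
by apply: sign_sup_flip => // t j; exact: envelope_g.
Qed.

(** Contraction replaces [g] by [L] times the identity on the polytope, where signed averages are at
    most [v s x + eps] by the inequalities that define it. *)
Lemma env_sup_mean x : N^-1 * \sum_s W s x <= L * (rad_mean x + eps).
Proof.
have H : \sum_s W s x <= \sum_s L * (v s x + eps).
  rewrite /W -[leLHS]mulr_sumr ler_pdivrMl//.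
  apply: (le_trans (sign_sup_contraction (L := L) (M := L * C) (envelope0 x) _ _ _)).
  - by move=> t i; exact: envelope_g.
  - by move=> t i [tC _]; rewrite normrM gtr0_norm// ler_pM2l.
  - by move=> t t' i [tC _] [tC' _]; exact: gL.
  rewrite mulr_sumr; apply: ler_sum => s _; apply: sign_sup_le => // t [_ ts].
  have -> : \sum_i sgnb (s i) * (L * t i) =
      n%:R * (L * (n%:R^-1 * \sum_i sgnb (s i) * t i)).
    rewrite !mulrA (mulrC n%:R) -(mulrA L) mulfV ?lt0r_neq0// mulr1 mulr_sumr.
    by apply: eq_bigr => i _; rewrite mulrCA.
  rewrite ler_pM2l// ler_pM2l//.
  exact: le_trans (ts s) (rounded_le x s).
rewrite mulrC ler_pdivrMr// (le_trans H)//.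
rewrite -mulr_sumr big_split/= sumr_const -mulrA ler_pM2l// mulrDl /rad_mean.
by rewrite -mulrA mulrCA mulVf ?lt0r_neq0// mulr1 -(mulr_natr eps).
Qed.

(** * Symmetrization and the exponential moment of the deviation *)

Variable lam : R.
Hypothesis lam0 : 0 < lam.

Definition neg_sign (s : S) : S := [ffun i => ~~ s i].

Lemma neg_signK : involutive neg_sign.
Proof. by move=> s; apply/ffunP => i; rewrite !ffunE negbK. Qed.

(** The factor [2] anticipates [exp (a + b) <= (exp (2 a) + exp (2 b)) / 2], which separates the two
    mixed samples. *)
Definition exp_env (s : S) (x : n.-tuple T) : R := expR (2 * lam * W s x).

Lemma bmeas_exp_env s : bmeas (exp_env s).
Proof. by apply/bmeas_expR/bmeasZ; exact: bmeas_env_sup. Qed.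

(* Swapping [x_i] and [y_i] wherever [s i] is false preserves [mu \x mu] and turns
   the difference of the two empirical means into a signed sum. *)
Definition sym_bound (s : S) (z : n.-tuple T * n.-tuple T) : R :=
  2^-1 * (exp_env s (mix s z.1 z.2) + exp_env (neg_sign s) (mix s z.2 z.1)).

Lemma bmeas_sym_bound s : bmeas (sym_bound s).
Proof.
apply/bmeasZ/bmeasD; apply: bmeas_comp (bmeas_exp_env _).
  exact: measurable_mix.
exact: (measurableT_comp (measurable_mix s) (@measurable_swap _ _ _ _)).
Qed.

(** For every fixed [s], the difference of empirical means is the signed average over [mix s x y]
    with signs [s] plus that over [mix s y x] with opposite signs; each is at most the corresponding
    [W]. *)
Lemma sym_bound_ge f s x y : Phi f ->
  expR (lam * (n%:R^-1 * \sum_(i < n) g (f (tnth y i)) -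
    n%:R^-1 * \sum_(i < n) g (f (tnth x i)))) <= sym_bound s (x, y).
Proof.
move=> Pf; rewrite /sym_bound /exp_env /=.
set a := W s _; set b := W _ _.
apply: (@le_trans _ _ (expR (lam * (a + b)))).
  rewrite ler_expR ler_pM2l//.
  have -> : n%:R^-1 * \sum_(i < n) g (f (tnth y i)) -
      n%:R^-1 * \sum_(i < n) g (f (tnth x i)) =
      rad_avg (fun z => g (f z)) (mix s x y) s +
      rad_avg (fun z => g (f z)) (mix s y x) (neg_sign s).
    rewrite /rad_avg -mulrBr -mulrDr -sumrB -big_split/=; congr (_ * _).
    apply: eq_bigr => i _; rewrite !tnth_mix ffunE /sgnb.
    by case: (s i) => /=; ring.
  by rewrite lerD// env_sup_ge.
(* The claim becomes [2 p q <= p^2 + q^2] for [p = exp (lam a)] and [q = exp (lam b)]. *)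
rewrite !(mulrC 2) -!mulrA !(mulrCA _ 2) !(mulrC 2).
have -> : lam * a * 2 = lam * a + lam * a by ring.
have -> : lam * b * 2 = lam * b + lam * b by ring.
rewrite mulrDr !expRD.
by set p := expR _; set q := expR _; have := sqr_ge0 (p - q); nra.
Qed.

(** Averages over signs and ghost sample; being measurable, it can replace the exponential of the
    supremum in Markov's inequality. *)
Definition dev_bound (x : n.-tuple T) : R :=
  N^-1 * \sum_s \int[mu]_y sym_bound s (x, y).

Lemma bmeas_dev_bound : bmeas dev_bound.
Proof.
apply/bmeasZ/bmeas_sum => s.
exact: (bmeas_Fubini_section mu mu (bmeas_sym_bound s)).
Qed.

Let bmeas_g f : Phi f -> bmeas (fun y => g (f y)).
Proof.
move=> Pf; split; first exact: mgPhi.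
by exists (L * C) => y; apply: gC; exact: PhiC.
Qed.

(** The integral under [Q] is the mean over a ghost sample [y] of an empirical average; Jensen's
    inequality moves the exponential inside that mean, where the symmetrized bound holds for each
    [y] and [s]. *)
Lemma dev_bound_ge f x : Phi f ->
  expR (lam * (\int[Q]_y g (f y) - n%:R^-1 * \sum_(i < n) g (f (tnth x i))))
  <= dev_bound x.
Proof.
move=> Pf; rewrite /dev_bound ler_pdivlMl//.
have -> r : N * r = \sum_(s : S) r by rewrite sumr_const mulr_natl.
apply: ler_sum => s _.
have bmean : bmeas (fun y : n.-tuple T => n%:R^-1 * \sum_(i < n) g (f (tnth y i))).
  apply/bmeasZ/bmeas_sum => i.
  by apply: (bmeas_comp (f := fun y => g (f y))) (bmeas_g Pf); exact: measurable_tnth.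
have -> : \int[Q]_y g (f y) =
    \int[mu]_y (n%:R^-1 * \sum_(i < n) g (f (tnth y i))).
  rewrite bmeas_RintegralZl; last first.
    apply: bmeas_sum => i.
    by apply: (bmeas_comp (f := fun y => g (f y))) (bmeas_g Pf); exact: measurable_tnth.
  rewrite bmeas_Rintegral_sum; last first.
    move=> i.
    by apply: (bmeas_comp (f := fun y => g (f y))) (bmeas_g Pf); exact: measurable_tnth.
  rewrite (eq_bigr (fun=> \int[Q]_y g (f y))) => [|i _].
    by rewrite sumr_const card_ord -(mulr_natl (Rintegral _ _ _)) mulKf// lt0r_neq0.
  exact: (Rintegral_tnth iidmu i (bmeas_g Pf)).
set r := n%:R^-1 * \sum_(i < n) g (f (tnth x i)).
have -> : lam * (\int[mu]_y (n%:R^-1 * \sum_(i < n) g (f (tnth y i))) - r) =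
    \int[mu]_y (lam * (n%:R^-1 * \sum_(i < n) g (f (tnth y i)) - r)).
  rewrite bmeas_RintegralZl; last by apply: bmeasB => //; exact: bmeas_cst.
  rewrite bmeas_RintegralB//; last exact: bmeas_cst.
  by rewrite Rintegral_probability_cst.
have bd : bmeas (fun y : n.-tuple T =>
    lam * (n%:R^-1 * \sum_(i < n) g (f (tnth y i)) - r)).
  by apply/bmeasZ/bmeasB => //; exact: bmeas_cst.
apply: (le_trans (expR_Rintegral_le mu bd)).
apply: bmeas_le_Rintegral; first exact: bmeas_expR.
  exact: (bmeas_section (bmeas_sym_bound s) x).
by move=> y; exact: sym_bound_ge.
Qed.

Lemma Rintegral_dev_bound :
  \int[mu]_x dev_bound x <=
  expR (n%:R * (40 * (lam * L * C / n%:R) ^+ 2) +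
    2 * lam * L * (\int[mu]_x rad_mean x + eps)).
Proof.
have b1 s : bmeas (fun x => \int[mu]_y sym_bound s (x, y)).
  exact: (bmeas_Fubini_section mu mu (bmeas_sym_bound s)).
(* Mixing preserves the law of one sample, so both halves of [sym_bound] reduce to one-sample
   expectations, and these have equal sums after reindexing by [neg_sign]. *)
have -> : \int[mu]_x dev_bound x = \int[mu]_x (N^-1 * \sum_s exp_env s x).
  rewrite bmeas_RintegralZl; last exact: bmeas_sum.
  rewrite bmeas_RintegralZl; last by apply: bmeas_sum => s; exact: bmeas_exp_env.
  congr (_ * _).
  transitivity (\sum_s \int[mu]_x exp_env s x); last first.
    by apply/esym/bmeas_Rintegral_sum => s; exact: bmeas_exp_env.
  rewrite [LHS]bmeas_Rintegral_sum//.
  have E s : \int[mu]_x \int[mu]_y sym_bound s (x, y) =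
      2^-1 * (\int[mu]_x exp_env s x + \int[mu]_x exp_env (neg_sign s) x).
    rewrite -(bmeas_Fubini mu mu (bmeas_sym_bound s)) /sym_bound.
    have be1 : bmeas (fun z : n.-tuple T * n.-tuple T => exp_env s (mix s z.1 z.2)).
      by apply: bmeas_comp (bmeas_exp_env _); exact: measurable_mix.
    have be2 : bmeas (fun z : n.-tuple T * n.-tuple T => exp_env (neg_sign s) (mix s z.2 z.1)).
      apply: bmeas_comp (bmeas_exp_env _).
      exact: (measurableT_comp (measurable_mix s) (@measurable_swap _ _ _ _)).
    rewrite bmeas_RintegralZl; last exact: bmeasD.
    rewrite bmeas_RintegralD//.
    congr (_ * (_ + _)).
      exact: (Rintegral_mix iidmu s (bmeas_exp_env s)).
    exact: (Rintegral_mix' iidmu s (bmeas_exp_env (neg_sign s))).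
  under eq_bigr do rewrite E.
  rewrite -mulr_sumr big_split/= [X in _ + X](reindex_inj (inv_inj neg_signK))/=.
  under [X in _ + X]eq_bigr do rewrite neg_signK.
  by field.
(* [c] bounds the effect of one sign on [2 lam W] and of one sample point on [F]. The two
   bounded-differences steps cost [n c^2 / 2] and [2 n c^2], which add up to the term with [40]. *)
pose c := 4 * (lam * L * C / n%:R).
pose F x := 2 * lam * L * rad_mean x.
have bF : bmeas F by apply/bmeasZ; exact: bmeas_rad_mean.
have Fc : bounded_differences c F.
  move=> i x y xy; rewrite /F -mulrBr normrM gtr0_norm ?mulr_gt0//.
  have -> : c = 2 * lam * L * (2 * C / n%:R) by rewrite /c; field; exact: lt0r_neq0.
  by rewrite ler_pM2l ?mulr_gt0//; exact: (bounded_differences_rad_mean xy).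
apply: (@le_trans _ _ (\int[mu]_x
    (expR (n%:R * (c ^+ 2 / 2) + 2 * lam * L * eps) * expR (F x)))).
  apply: bmeas_le_Rintegral.
  - by apply/bmeasZ/bmeas_sum => s; exact: bmeas_exp_env.
  - exact/bmeasZ/bmeas_expR.
  move=> x; rewrite ler_pdivrMl//.
  have Wc i s : `|2 * lam * W s x - 2 * lam * W (flip i s) x| <= c.
    rewrite -mulrBr normrM gtr0_norm ?mulr_gt0//.
    have -> : c = 2 * lam * (2 * (L * C) / n%:R) by rewrite /c; field; exact: lt0r_neq0.
    by rewrite ler_pM2l ?mulr_gt0//; exact: env_sup_flip.
  rewrite (le_trans (expR_bounded_differences_signs Wc))// ler_pM2l//.
  rewrite -expRD ler_expR -addrA lerD2l -mulr_sumr mulrCA.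
  have -> : 2 * lam * L * eps + F x = 2 * lam * (L * (rad_mean x + eps)).
    by rewrite /F; ring.
  by rewrite ler_pM2l ?mulr_gt0//; exact: env_sup_mean.
rewrite bmeas_RintegralZl; last exact: bmeas_expR.
rewrite -ler_pdivlMl ?expR_gt0// -expRN -expRD.
rewrite (le_trans (expR_bounded_differences iidmu bF Fc))// ler_expR.
rewrite /F bmeas_RintegralZl; last exact: bmeas_rad_mean.
rewrite le_eqVlt; apply/orP; left; apply/eqP; rewrite /c; field.
exact: lt0r_neq0.
Qed.

(* With these choices of [lam] and [eps] the exponent supplied by
   [Rintegral_dev_bound] is [41 n r^2 + 2 lam L Rad], and [lam tau] exceeds it by
   [2 n r^2]. *)
Lemma deviation_exp r tau : lam = n%:R * r / (L * C) -> 0 < C -> eps = C * r / 2 ->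
  tau = 2 * L * \int[mu]_x rad_mean x + 43 * (L * C) * r ->
  exists E : set (n.-tuple T), [/\ measurable E,
    (mu (~` E) <= (expR (- (2 * n%:R * r ^+ 2)))%:E)%E &
    forall x, E x -> forall f, Phi f ->
      \int[Q]_y g (f y) - n%:R^-1 * \sum_(i < n) g (f (tnth x i)) <= tau].
Proof.
move=> lamE C_gt0 epsE tauE.
have mB : measurable [set x | expR (lam * tau) < dev_bound x].
  rewrite (_ : [set x | _] = setT `&` dev_bound @^-1` `]expR (lam * tau), +oo[%classic).
    by apply: bmeas_dev_bound.1.
  by rewrite setTI; apply/seteqP; split => x /=; rewrite in_itv/= andbT.
exists (~` [set x | expR (lam * tau) < dev_bound x]); split.
- exact: measurableC.
- rewrite setCK (le_trans (bmeas_markov mu bmeas_dev_bound _ (expR_gt0 _)))//.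
    move=> x; apply: (le_trans (expR_ge0 _) (dev_bound_ge x Phif0)).
  rewrite lee_fin -expRN (le_trans (ler_wpM2l (expR_ge0 _) Rintegral_dev_bound))//.
  rewrite -expRD ler_expR le_eqVlt; apply/orP; left; apply/eqP.
  rewrite tauE epsE lamE; field.
  by rewrite !lt0r_neq0.
- move=> x /= /negP; rewrite -leNgt => xE f Pf.
  rewrite -(ler_pM2l lam0) -ler_expR; exact: le_trans (dev_bound_ge x Pf) xE.
Qed.

End deviation.

(** * Measurability of Lipschitz compositions and change of density *)

Lemma measurable_lipschitz_comp {R : realType} {d} {T : measurableType d}
    (C L : R) (g : R -> R) (f : T -> R) :
  0 < L -> lipschitz_on_sym_interval C L g -> measurable_fun setT f ->
  (forall x, `|f x| <= C) -> measurable_fun setT (fun x => g (f x)).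
Proof.
move=> L0 gL mf fC; have C0 : 0 <= C := le_trans (normr_ge0 _) (fC point).
(* [g] is controlled only on [[-C, C]]; clipping its argument gives a function continuous everywhere
   that agrees with [g] on the range of [f]. *)
pose clip (u : R) := if u < - C then - C else if C < u then C else u.
have clipC u : `|clip u| <= C.
  by rewrite ler_norml /clip; case: (ltP u (- C)) => ?; case: (ltP C u) => ?; lra.
have clip_id u : `|u| <= C -> clip u = u.
  rewrite ler_norml /clip => /andP[? ?].
  by case: (ltP u (- C)) => ?; case: (ltP C u) => ?; lra.
have clip_le u w : u <= w -> 0 <= clip w - clip u <= w - u.
  move=> uw; rewrite /clip; case: (ltP u (- C)) => ?; case: (ltP w (- C)) => ?;
    case: (ltP C u) => ?; case: (ltP C w) => ?; lra.
have clipL u w : `|clip u - clip w| <= `|u - w|.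
  wlog uw : u w / u <= w => [H|].
    by have [/H//|/ltW/H] := leP u w; rewrite distrC (distrC u).
  have /andP[clip0 clip1] := clip_le u w uw.
  by rewrite distrC (distrC u) !ger0_norm// subr_ge0.
have cg : continuous (fun u => g (clip u)).
  move=> u; apply/cvgrPdist_lt => e e0; near=> w.
  rewrite (le_lt_trans (gL _ _ (clipC u) (clipC w)))//.
  rewrite (le_lt_trans (ler_wpM2l (ltW L0) (clipL u w)))// mulrC -ltr_pdivlMr//.
  by near: w; apply: cvgr_dist_lt => //; rewrite divr_gt0.
rewrite (_ : (fun x => _) = (fun u => g (clip u)) \o f).
  by apply: measurableT_comp => //; exact: continuous_measurable_fun.
by apply/funext => x /=; rewrite clip_id.
Unshelve. all: by end_near. Qed.

Lemma Rintegral_density {R : realType} {d} {T : measurableType d}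
    (Q P : probability T R) (phi k : T -> R) : bmeas phi -> bmeas k ->
  (forall A, measurable A -> P A = (\int[Q]_(x in A) (phi x)%:E)%E) ->
  \int[P]_x k x = \int[Q]_x (k x * phi x).
Proof.
move=> bphi bk Pphi; congr fine.
have mphi : measurable_fun setT (EFin \o phi) by exact/measurable_EFinP/bphi.1.
have mk : measurable_fun setT (EFin \o k) by exact/measurable_EFinP/bk.1.
have PQ : P `<< Q.
  apply/null_content_dominatesP => A mA QA; rewrite Pphi//.
  by apply: null_set_integral => //; exact: measurable_funTS.
rewrite -(Radon_Nikodym_change_of_variables PQ measurableT (bmeas_integrable P bk)).
apply: ae_eq_integral => //.
- exact: emeasurable_funM.
- exact/measurable_EFinP/(bmeasM bk bphi).1.
rewrite [X in ae_eq _ _ _ X](_ : _ = (EFin \o k) \* (EFin \o phi))%E; last first.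
  by apply/funext => x /=; rewrite EFinM.
(* [phi] and the Radon-Nikodym derivative have equal integrals over all measurable sets, so they
   agree almost everywhere. *)
apply: ae_eqe_mul2l; apply: integral_ae_eq => //.
- exact: Radon_Nikodym_integrable.
- by move=> A _ mA; rewrite -Radon_Nikodym_integral//= Pphi.
Qed.

(** * Uniform deviation bound for a Lipschitz function of the class *)

Section uniform_deviation.
Context {R : realType} {d : measure_display} {T : measurableType d}.
Variables (Q : probability T R) (n : nat) (mu : probability (n.-tuple T) R).
Variables (Phi : set (T -> R)) (f0 : T -> R) (C : R).
Hypotheses (n0 : (0 < n)%N) (iidmu : iid_law Q mu) (C0 : 0 < C).
Hypothesis mPhi : forall f, Phi f -> measurable_fun setT f.
Hypothesis PhiC : forall f, Phi f -> forall x, `|f x| <= C.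
Hypothesis Phif0 : Phi f0.
Hypothesis mrad : forall s, measurable_fun setT (fun x : n.-tuple T => rad_sup Phi x s).

(** Subtracting [g 0] leaves the deviation unchanged and makes the function bounded by [L C] on the
    interval; [lam] and [eps] are then those prescribed by [deviation_exp]. *)
Lemma uniform_deviation (g : R -> R) (L r : R) :
  0 < L -> 0 < r -> lipschitz_on_sym_interval C L g ->
  exists E : set (n.-tuple T), [/\ measurable E,
    (mu (~` E) <= (expR (- (2 * n%:R * r ^+ 2)))%:E)%E &
    forall x, E x -> forall f, Phi f ->
      \int[Q]_y g (f y) - n%:R^-1 * \sum_(i < n) g (f (tnth x i)) <=
      2 * L * \int[mu]_x rad_mean Phi x + 43 * (L * C) * r].
Proof.
move=> L0 r0 gL; pose g0 u := g u - g 0.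
have nR0 : 0 < n%:R :> R by rewrite ltr0n.
have C00 : `|0 : R| <= C by rewrite normr0 ltW.
have g0L : lipschitz_on_sym_interval C L g0.
  by move=> u w uC wC; rewrite /g0 opprB addrA subrK; exact: gL.
have g0C u : `|u| <= C -> `|g0 u| <= L * C.
  move=> uC; rewrite (le_trans (gL _ _ uC C00))// subr0.
  by rewrite ler_pM2l.
have mg h : lipschitz_on_sym_interval C L h -> forall f, Phi f ->
    measurable_fun setT (fun x => h (f x)).
  by move=> hL f Pf; apply: (measurable_lipschitz_comp L0 hL); [exact: mPhi|exact: PhiC].
have eps0 : 0 < C * r / 2 by rewrite divr_gt0 ?mulr_gt0.
have lam0 : 0 < n%:R * r / (L * C) by rewrite divr_gt0 ?mulr_gt0.
have [E [mE muE EP]] := deviation_exp n0 iidmu PhiC Phif0 mrad L0 eps0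
  g0L g0C (mg _ g0L) lam0 erefl C0 erefl erefl.
exists E; split => // x Ex f Pf; rewrite (le_trans _ (EP x Ex f Pf))//.
have bg : bmeas (fun y => g (f y)).
  split; first exact: mg.
  exists (L * C + `|g 0|) => y; rewrite -[g (f y)](subrK (g 0)).
  by rewrite (le_trans (ler_normD _ _))// lerD2r g0C// PhiC.
rewrite /g0 bmeas_RintegralB//; last exact: bmeas_cst.
rewrite Rintegral_probability_cst sumrB mulrBr sumr_const card_ord -(mulr_natl (g 0)).
by rewrite mulKf ?lt0r_neq0//; lra.
Qed.

End uniform_deviation.

(** * Lipschitz continuity of [eta'(u) u - eta(u)] *)

Section legendre.
Context {R : realType}.
Variables (eta : R -> R) (C L : R).
Hypothesis L0 : 0 <= L.
Hypothesis deta : forall x : R, derivable eta x 1.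
Hypothesis eta'L : lipschitz_on_sym_interval C L (derive1 eta).

Lemma derivable_MVT u w : u <= w ->
  exists2 c, u <= c <= w & eta w - eta u = derive1 eta c * (w - u).
Proof.
move=> uw; have [||c] := @MVT_segment R eta (derive1 eta) u w uw.
- by move=> x _; rewrite derive1E; exact: derivableP.
- apply: continuous_subspaceT => x; apply: differentiable_continuous.
  exact/derivable1_diffP.
- by rewrite in_itv/= => uc E; exists c.
Qed.

(** With [c] from the mean value theorem, the increment is [(eta' w - eta' u) w + (eta' u - eta' c)
    (w - u)]; the two terms contribute [C L] and [2 C L]. *)
Lemma legendre_lipschitz :
  lipschitz_on_sym_interval C (3 * C * L) (fun u => derive1 eta u * u - eta u).
Proof.
have H u w : u <= w -> `|u| <= C -> `|w| <= C ->
    `|(derive1 eta w * w - eta w) - (derive1 eta u * u - eta u)| <= 3 * C * L * (w - u).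
  move=> uw uC wC; have [c /andP[uc cw] E] := derivable_MVT uw.
  have cC : `|c| <= C.
    by move: uC wC; rewrite !ler_norml => /andP[? ?] /andP[? ?]; lra.
  have -> : (derive1 eta w * w - eta w) - (derive1 eta u * u - eta u) =
      (derive1 eta w - derive1 eta u) * w + (derive1 eta u - derive1 eta c) * (w - u).
    by rewrite -[eta w](subrK (eta u)) E; ring.
  have wu : 0 <= w - u by lra.
  have A1 : `|derive1 eta w - derive1 eta u| * `|w| <= L * (w - u) * C.
    by rewrite ler_pM// (le_trans (eta'L wC uC))// ger0_norm.
  have A2 : `|derive1 eta u - derive1 eta c| * `|w - u| <= L * (2 * C) * (w - u).
    rewrite (ger0_norm wu) ler_wpM2r// (le_trans (eta'L uC cC))// ler_wpM2l//.
    by rewrite (le_trans (ler_normB _ _))//; lra.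
  by rewrite (le_trans (ler_normD _ _))// !normrM; lra.
move=> u w uC wC; have [uw|/ltW uw] := leP u w.
  by rewrite distrC (distrC u) (ger0_norm (_ : 0 <= w - u)) ?subr_ge0//; exact: H.
by rewrite (ger0_norm (_ : 0 <= u - w)) ?subr_ge0//; exact: H.
Qed.

End legendre.

Lemma lipschitz_on_sym_intervalN {R : realType} (C L : R) (g : R -> R) :
  lipschitz_on_sym_interval C L g -> lipschitz_on_sym_interval C L (fun u => - g u).
Proof. by move=> gL u w uC wC; rewrite -opprD normrN; exact: gL. Qed.

Lemma lipschitz_on_sym_interval_le {R : realType} (C L L' : R) (g : R -> R) :
  L <= L' -> lipschitz_on_sym_interval C L g -> lipschitz_on_sym_interval C L' g.
Proof.
by move=> LL' gL u w uC wC; rewrite (le_trans (gL _ _ uC wC))// ler_wpM2r.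
Qed.

Lemma probability_setI_ge {R : realType} {d} {T : measurableType d}
    (mu : probability T R) (A B : set T) (a : R) : measurable A -> measurable B ->
  (mu (~` A) <= a%:E)%E -> (mu (~` B) <= a%:E)%E ->
  ((1 - (a + a))%:E <= mu (A `&` B))%E.
Proof.
move=> mA mB Aa Ba; have mAB := measurableI _ _ mA mB.
have : (mu (~` (A `&` B)) <= (a + a)%:E)%E.
  rewrite setCI EFinD (le_trans _ (leeD Aa Ba))//.
  by apply: measureU2; exact: measurableC.
rewrite probability_setC// -(fineK (fin_num_measure mu _ mAB)) -EFinB !lee_fin.
lra.
Qed.

Lemma bmeas_RintegralN {R : realType} {d} {T : measurableType d}
    (mu : probability T R) (f : T -> R) : bmeas f ->
  \int[mu]_x - f x = - \int[mu]_x f x.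
Proof.
by move=> bf; rewrite -mulN1r -bmeas_RintegralZl//; apply: eq_Rintegral => x _; rewrite mulN1r.
Qed.

(** * The Bregman bound for the empirical minimizer *)

Unset Implicit Arguments.
Set Strict Implicit.

Theorem theorem5 (R : realType) :
  exists c1 c2 m1 m2 : R -> R -> R -> R -> R,
    (forall a b c e : R,
        0 < c1 a b c e /\ 0 < c2 a b c e /\ 0 < m1 a b c e /\ 0 < m2 a b c e) /\
    forall (d : measure_display) (T : measurableType d)
      (Q P : probability T R) (phi : T -> R) (Phi : set (T -> R))
      (eta : R -> R) (C_phi L_eta L'_eta C_eta : R) (n nu : nat)
      (mu : probability (n.-tuple T) R) (muu : probability (nu.-tuple T) R)
      (Pr : probability (n.-tuple T * nu.-tuple T)%type R)
      (phi_star : (n.-tuple T * nu.-tuple T)%type -> (T -> R)) (delta : R),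
    (0 < n)%N -> (0 < nu)%N ->
    (* eta differentiable and strictly convex *)
    (forall x : R, derivable eta x 1) ->
    strictly_convex eta ->
    (* regularity of eta on [-C_phi, C_phi] *)
    lipschitz_on_sym_interval C_phi L_eta eta ->
    (forall x : R, `|x| <= C_phi -> `|eta x| <= C_eta) ->
    lipschitz_on_sym_interval C_phi L'_eta (derive1 eta) ->
    (* the hypothesis class *)
    (forall f, Phi f -> measurable_fun setT f) ->
    (forall f, Phi f -> forall x, `|f x| <= C_phi) ->
    (* phi is the true density ratio dP/dQ and belongs to Phi *)
    measurable_fun setT phi ->
    (forall A, measurable A -> P A = (\int[Q]_(x in A) (phi x)%:E)%E) ->
    Phi phi ->
    (* sampling: x_1..x_n iid ~ Q = p(x|y_s), x^u_1..x^u_nu iid ~ P = p(x) *)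
    sample_law Q P Pr ->
    (* laws used to define the Rademacher complexities *)
    iid_law Q mu -> iid_law P muu ->
    (forall s, measurable_fun setT (fun x : n.-tuple T => rad_sup Phi x s)) ->
    (forall s, measurable_fun setT (fun x : nu.-tuple T => rad_sup Phi x s)) ->
    (* phi_star is an empirical risk minimizer over Phi *)
    (forall z, Phi (phi_star z)) ->
    (forall z f, Phi f -> J_hat eta z (phi_star z) <= J_hat eta z f) ->
    0 < delta < 1 ->
    exists E : set (n.-tuple T * nu.-tuple T)%type,
      measurable E /\ ((1 - delta)%:E <= Pr E)%E /\
      forall z, E z ->
        (bregman eta Q phi (phi_star z) <=
           (c1 C_phi L_eta L'_eta C_eta)%:E * rademacher mu Phi
         + (c2 C_phi L_eta L'_eta C_eta)%:E * rademacher muu Phi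
         + (m1 C_phi L_eta L'_eta C_eta
              * Num.sqrt (ln (4 / delta) / (2 * n%:R)))%:E
         + (m2 C_phi L_eta L'_eta C_eta
              * Num.sqrt (ln (4 / delta) / (2 * nu%:R)))%:E)%E.
Proof.
(* Adding [1] to absolute values keeps the constants positive for all arguments and above the
   Lipschitz constants of [h] and [eta']. *)
pose L1 (a c : R) := 3 * (`|a| + 1) * (`|c| + 1).
pose L2 (c : R) := `|c| + 1.
have L2_gt0 c : 0 < L2 c by rewrite ltr_pwDr.
have L1_gt0 a c : 0 < L1 a c by rewrite !mulr_gt0// ltr_pwDr.
(* Each sample contributes two one-sided deviations, each with [2 L] times the complexity and
   [43 L C] times the square root; hence [4] and [86]. *)
exists (fun a _ c _ => 4 * L1 a c), (fun _ _ c _ => 4 * L2 c),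
  (fun a _ c _ => 86 * (L1 a c * (`|a| + 1))), (fun a _ c _ => 86 * (L2 c * (`|a| + 1))).
split; first by move=> a b c e; rewrite !mulr_gt0// ltr_pwDr.
move=> d T Q P phi Phi eta C Le L' Ce n nu mu muu Pr phis delta n0 nu0 deta _ _ _
  eta'L mPhi PhiC mphi Pphi Phiphi law iidmu iidmuu mrad mradu Phis erm /andP[del0 del1].
(* If [C <= 0], then [phi] vanishes and [P] would have total mass [0]. *)
have C0 : 0 < C.
  rewrite ltNge; apply/negP => C0; have := Pphi _ measurableT.
  rewrite probability_setT integral0_eq => [/eqP|x _]; first by rewrite onee_eq0.
  by apply/eqP; rewrite eqe -normr_le0 (le_trans (PhiC _ Phiphi x)).
have L'0 : 0 <= L'.
  have C00 : `|0 : R| <= C by rewrite normr0 ltW.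
  have CC : `|C| <= C by rewrite gtr0_norm.
  have := le_trans (normr_ge0 _) (eta'L _ _ CC C00).
  by rewrite subr0 (gtr0_norm C0) pmulr_lge0.
pose h u := derive1 eta u * u - eta u.
have kL : lipschitz_on_sym_interval C (L2 L') (derive1 eta).
  apply: lipschitz_on_sym_interval_le eta'L.
  by rewrite /L2; have := ler_norm L'; lra.
have hL : lipschitz_on_sym_interval C (L1 C L') h.
  apply: lipschitz_on_sym_interval_le (legendre_lipschitz L'0 deta eta'L).
  rewrite /L1 (gtr0_norm C0) (ger0_norm L'0); nra.
have ell0 : 0 < ln (4 / delta) by rewrite ln_gt0// ltr_pdivlMr//; lra.
have sqrt_gt0 m : (0 < m)%N -> 0 < Num.sqrt (ln (4 / delta) / (2 * m%:R)) :> R.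
  by move=> m0; rewrite sqrtr_gt0 divr_gt0// mulr_gt0// ltr0n.
(* With this radius, each of the four events below fails with probability at most [delta / 4]. *)
have expE m : (0 < m)%N ->
    expR (- (2 * m%:R * Num.sqrt (ln (4 / delta) / (2 * m%:R)) ^+ 2)) = delta / 4 :> R.
  move=> m0; rewrite sqr_sqrtr; last by rewrite divr_ge0 ?ltW// mulr_gt0// ltr0n.
  rewrite mulrCA mulfV ?mulr1; last by rewrite lt0r_neq0// mulr_gt0// ltr0n.
  by rewrite expRN lnK ?posrE ?divr_gt0// invf_div.
have [E1 [mE1 muE1 E1P]] := uniform_deviation n0 iidmu C0 mPhi PhiC Phiphi mrad
  (L1_gt0 C L') (sqrt_gt0 n n0) hL.
have [E2 [mE2 muE2 E2P]] := uniform_deviation n0 iidmu C0 mPhi PhiC Phiphi mrad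
  (L1_gt0 C L') (sqrt_gt0 n n0) (lipschitz_on_sym_intervalN hL).
have [F1 [mF1 muF1 F1P]] := uniform_deviation nu0 iidmuu C0 mPhi PhiC Phiphi mradu
  (L2_gt0 L') (sqrt_gt0 nu nu0) kL.
have [F2 [mF2 muF2 F2P]] := uniform_deviation nu0 iidmuu C0 mPhi PhiC Phiphi mradu
  (L2_gt0 L') (sqrt_gt0 nu nu0) (lipschitz_on_sym_intervalN kL).
rewrite !expE// in muE1 muE2 muF1 muF2.
exists ((E1 `&` E2) `*` (F1 `&` F2)).
have mE12 := measurableI _ _ mE1 mE2; have mF12 := measurableI _ _ mF1 mF2.
split; first exact: measurableX.
split.
  rewrite (sample_law_product iidmu iidmuu law); last exact: measurableX.
  rewrite [leRHS]product_measure1E//.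
  have h1 := probability_setI_ge mE1 mE2 muE1 muE2.
  have h2 := probability_setI_ge mF1 mF2 muF1 muF2.
  (* Independence multiplies the two probabilities, and [(1 - delta / 2)^2 >= 1 - delta]. *)
  apply: (@le_trans _ _ ((1 - (delta / 4 + delta / 4))%:E * (1 - (delta / 4 + delta / 4))%:E)%E).
    by rewrite -EFinM lee_fin; nra.
  by apply: lee_pmul => //; rewrite lee_fin; lra.
move=> z [[/= E1z E2z] [F1z F2z]]; set f := phis z.
have Pf : Phi f by exact: Phis.
rewrite (rademacherE mu n0 PhiC Phiphi mrad) (rademacherE muu nu0 PhiC Phiphi mradu).
have bc g L : 0 < L -> lipschitz_on_sym_interval C L g -> forall f, Phi f ->
    bmeas (fun x => g (f x)).
  move=> L0 gL q Pq; split.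
    by apply: (measurable_lipschitz_comp L0 gL); [exact: mPhi|exact: PhiC].
  exists (L * (C + C) + `|g 0|) => x; rewrite -[g (q x)](subrK (g 0)).
  have C00 : `|0 : R| <= C by rewrite normr0 ltW.
  rewrite (le_trans (ler_normD _ _))// lerD2r (le_trans (gL _ _ (PhiC _ Pq x) C00))//.
  by rewrite ler_pM2l// subr0 (le_trans (PhiC _ Pq x))// lerDl ltW.
have bh q : Phi q -> bmeas (fun x => h (q x)) by exact: (bc h _ (L1_gt0 C L') hL).
have bk q : Phi q -> bmeas (fun x => derive1 eta (q x)).
  exact: (bc (derive1 eta) _ (L2_gt0 L') kL).
have bphi : bmeas phi by split => //; exists C; exact: PhiC.
(* The divergence as the excess risk [J(f) - J(phi)]: the density turns [eta'(.) phi] under [Q] into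
   [eta'(.)] under [P]. *)
have bregE : bregman eta Q phi f =
    ((\int[Q]_x h (f x) - \int[Q]_x h (phi x)) -
     (\int[P]_x derive1 eta (f x) - \int[P]_x derive1 eta (phi x)))%:E.
  rewrite (Rintegral_density bphi (bk _ Pf) Pphi) (Rintegral_density bphi (bk _ Phiphi) Pphi).
  have b1 := bmeasM (bk _ Pf) bphi; have b2 := bmeasM (bk _ Phiphi) bphi.
  have b3 := bh _ Pf; have b4 := bh _ Phiphi.
  rewrite -!bmeas_RintegralB//; [|exact: bmeasB|exact: bmeasB].
  rewrite EFin_Rintegral; last by apply: bmeasB; exact: bmeasB.
  by apply: eq_integral => x _; congr (_%:E); rewrite /h; ring.
rewrite bregE -!EFinM -!EFinD lee_fin.
(* The deviation of [h] is taken at [f] and that of [-h] at [phi], with the roles exchanged for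
   [eta']; minimality of [f] then disposes of the empirical terms. *)
have := E1P _ E1z _ Pf; have := E2P _ E2z _ Phiphi.
have := F1P _ F1z _ Phiphi; have := F2P _ F2z _ Pf.
have := erm z _ Phiphi; rewrite -/f /J_hat.
rewrite (bmeas_RintegralN _ (bk _ Pf)) (bmeas_RintegralN _ (bh _ Phiphi)) !sumrN.
have hn q : n%:R^-1 * \sum_(i < n) h (q (tnth z.1 i)) =
    n%:R^-1 * (\sum_(i < n) derive1 eta (q (tnth z.1 i)) * q (tnth z.1 i)) -
    n%:R^-1 * \sum_(i < n) eta (q (tnth z.1 i)).
  by rewrite -mulrBr -sumrB.
rewrite !mulrN !hn.
have r1_gt0 := sqrt_gt0 n n0; have r2_gt0 := sqrt_gt0 nu nu0.
(* Passes from [C] in the deviation bounds to the [|C| + 1] in the chosen constants. *)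
have mono L r : 0 < L -> 0 < r -> 43 * (L * C) * r <= 43 * (L * (`|C| + 1)) * r.
  by move=> Lp rp; rewrite ler_pM2r// ler_pM2l// ler_pM2l// gtr0_norm// lerDl.
have := mono _ _ (L1_gt0 C L') r1_gt0; have := mono _ _ (L2_gt0 L') r2_gt0.
move: (\int[Q]_x h (f x)) (\int[Q]_x h (phi x)) (\int[P]_x derive1 eta (f x))
  (\int[P]_x derive1 eta (phi x)) (\int[mu]_x rad_mean Phi x)
  (\int[muu]_x rad_mean Phi x) (L1 C L') (L2 L').
by clear => *; lra.
Qed.
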